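(* Let $X=(M,J)$ be a compact complex manifold with a locally conformally Kähler (l.c.k.) structure $\omega$, let $L$ be the corresponding flat line bundle to $\omega$, and let $\{L_s\}$ be a family of deformations of flat line bundles with $L_0=L$, parametrized by real $s$ near $0$ and given by a family of $d$-closed $1$-forms $\{\eta_s\}$. Put $\dot\eta_0:=\frac{d}{ds}\eta_s\big|_{s=0}$. If the class $[\dot\eta_0\wedge\omega]\in H^3(X,L)$ does not vanish, then $X$ does not admit a smooth family of l.c.k. forms $\{\omega_s\}$ such that $L_s$ is the corresponding flat line bundle to $\omega_s$ for all small $s$.
   Context: An l.c.k. structure (or l.c.k. form) on a complex manifold $(M,J)$ is the fundamental $2$-form $\omega$ of a Hermitian metric such that $d\omega=\eta\wedge\omega$ for some $d$-closed real $1$-form $\eta$, called the Lee form. Corresponding flat line bundle: choose an open cover $\{U_i\}$ of $M$ whose finite intersections have vanishing real cohomology in positive degrees, and functions $f_i$ on $U_i$ with $\eta|_{U_i}=df_i$; then $\lambda_{ij}=f_i-f_j$ is constant on $U_i\cap U_j$. The corresponding flat line bundle $L$ to $\omega$ is the real flat line bundle over $M$ with locally constant transition functions $e^{-\lambda_{ij}}$; it is determined by the class of this cocycle in the first Čech cohomology group of $M$ with values in $\mathbb{R}^*$. An $L$-valued $k$-form is a collection $\{\alpha_i\}$ of $k$-forms $\alpha_i$ on $U_i$ with $\alpha_i=e^{-\lambda_{ij}}\alpha_j$; the exterior derivative induces $d_L$ on $L$-valued forms, and $H^\bullet(X,L)$ is the cohomology of $(\wedge^\bullet\otimes L,d_L)$.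 The map sending an ordinary form $\alpha$ to $\{e^{-f_i}\alpha\}$ identifies $(\wedge^\bullet,d-\eta\wedge)$ with $(\wedge^\bullet\otimes L,d_L)$; through it the $(d-\eta\wedge)$-closed form $\dot\eta_0\wedge\omega$ defines a class $[\dot\eta_0\wedge\omega]\in H^3(X,L)$. The deformations $\{L_s\}$ are described by $d$-closed $1$-forms $\eta_s$ (smooth in $s$, normalized by $\eta_0=0$), representing classes in $H^1(M,\mathbb{R})$: $L_s$ is the flat line bundle whose flat sections are the sections $\sigma$ of $L$ with $(d_L+\eta_s)\sigma=0$. *)

(* Defs.v *)
From HB Require Import structures.
From mathcomp Require Import all_boot all_order all_algebra.
From mathcomp Require Import all_classical all_reals all_analysis.

Set Implicit Arguments.
Unset Strict Implicit.
Unset Printing Implicit Defensive.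

Import Order.TTheory GRing.Theory Num.Theory.
Import numFieldNormedType.Exports.

Local Open Scope classical_set_scope.
Local Open Scope ring_scope.

Section Smooth.
Variables (R : realType) (V W : normedModType R).

Definition iter_derive (f : V -> W) (vs : seq V) : V -> W :=
  foldr (fun v g x => 'D_v g x) f vs.

(* C^oo on the open set A: all iterated directional derivatives exist and are
   continuous on A. *)
Definition smooth_on (A : set V) (f : V -> W) : Prop :=
  forall (vs : seq V) (x : V), A x ->
    {for x, continuous (iter_derive f vs)} /\
    (forall v : V, derivable (iter_derive f vs) x v).

End Smooth.

(* C^n is R^n x R^n, the vector (x, y) standing for x + iy, and J is the
   multiplication by i. *)
Notation Cn R n := 'rV[R]_(n + n).

Definition J (R : realType) (n : nat) (v : Cn R n) : Cn R n :=
  row_mx (- rsubmx v) (lsubmx v).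

Record complex_manifold (R : realType) (n : nat) := ComplexManifold {
  carrier :> topologicalType ;
  carrier_hausdorff : hausdorff_space carrier ;
  carrier_second_countable : @second_countable carrier ;
  chart : Type ;
  dom : chart -> set carrier ;
  coord : chart -> carrier -> Cn R n ;
  param : chart -> Cn R n -> carrier ;
  dom_open : forall a, open (dom a) ;
  dom_cover : forall p, exists a, dom a p ;
  coord_open : forall a, open (coord a @` dom a) ;
  coordK : forall a p, dom a p -> param a (coord a p) = p ;
  coord_continuous : forall a p, dom a p -> {for p, continuous (coord a)} ;
  param_continuous :
    forall a x, (coord a @` dom a) x -> {for x, continuous (param a)} ;
  transition_smooth : forall a b,
    smooth_on (coord a @` (dom a `&` dom b)) (coord b \o param a) ;
  (* Cauchy-Riemann equations *)
  transition_holomorphic : forall a b x, (coord a @` (dom a `&` dom b)) x ->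
    forall v, 'D_(J v) (coord b \o param a) x =
              J ('D_v (coord b \o param a) x)
}.

Section Forms.
Variables (R : realType) (n : nat) (X : complex_manifold R n).

Definition chart_image (a : chart X) (W : set X) : set (Cn R n) :=
  coord a @` (dom a `&` W).

Definition transition (a b : chart X) : Cn R n -> Cn R n :=
  coord b \o param a.

(* The local expressions of a differential form in the charts: [al a x v] is
   the value on the vectors v_0, ..., v_(k-1) of the coordinate expression of
   [al] in the chart a, at the point x.  Only the values at the points x of
   the image of the chart are meaningful. *)
Definition local_expr (k : nat) : Type :=
  chart X -> Cn R n -> ('I_k -> Cn R n) -> R.

Definition form_eq (W : set X) (k : nat) (al be : local_expr k) : Prop :=
  forall a x, chart_image a W x -> forall v, al a x v = be a x v.

Definition is_form (W : set X) (k : nat) (al : local_expr k) : Prop :=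
  [/\ forall a v, smooth_on (chart_image a W) (fun x => al a x v),
      forall a x, chart_image a W x -> forall v i (c : R) u w,
        al a x (dfwith v i (c *: u + w)) =
        c * al a x (dfwith v i u) + al a x (dfwith v i w),
      forall a x, chart_image a W x -> forall v i j,
        i != j -> v i = v j -> al a x v = 0
    & forall a b x, chart_image a (dom b `&` W) x -> forall v,
        al a x v =
        al b (transition a b x) (fun j => 'D_(v j) (transition a b) x)].

Definition form0 (f : X -> R) : local_expr 0 := fun a x _ => f (param a x).

Definition smooth_function (W : set X) (f : X -> R) : Prop :=
  is_form W (form0 f).

Definition addf k (al be : local_expr k) : local_expr k :=
  fun a x v => al a x v + be a x v.

Definition mulf k (f : X -> R) (al : local_expr k) : local_expr k :=
  fun a x v => f (param a x) * al a x v.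

Definition zerof k : local_expr k := fun _ _ _ => 0.

(* d and the wedge product by a 1-form, both in the normalization
   (dx_1 /\ ... /\ dx_k)(e_1, ..., e_k) = 1. *)
Definition dform k (al : local_expr k) : local_expr k.+1 :=
  fun a x v => \sum_(i < k.+1)
    (-1) ^+ i * 'D_(v i) (fun y => al a y (fun j => v (lift i j))) x.

Definition wedge1 k (th : local_expr 1) (al : local_expr k) :
    local_expr k.+1 :=
  fun a x v => \sum_(i < k.+1)
    (-1) ^+ i * th a x (fun=> v i) * al a x (fun j => v (lift i j)).

Definition closed_form (W : set X) k (al : local_expr k) : Prop :=
  is_form W al /\ form_eq W (dform al) (@zerof k.+1).

Definition smooth_family (e : R) k (al : R -> local_expr k) : Prop :=
  (forall s, `|s| < e -> is_form setT (al s)) /\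
  (forall a v, smooth_on
     [set z : (R * Cn R n)%type | `|z.1| < e /\ chart_image a setT z.2]
     (fun z => al z.1 a z.2 v)).

Definition dot0 k (al : R -> local_expr k) : local_expr k :=
  fun a x v => derive1 (fun s : R => al s a x v) 0.

Definition hermitian_metric (g : chart X -> Cn R n -> Cn R n -> Cn R n -> R) :
    Prop :=
  (forall a u v, smooth_on (chart_image a setT) (fun x => g a x u v)) /\
  (forall a x, chart_image a setT x ->
    [/\ forall (c : R) u v w, g a x (c *: u + v) w = c * g a x u w + g a x v w,
        forall u v, g a x u v = g a x v u,
        forall u v, g a x (J u) (J v) = g a x u v
      & forall u, u != 0 -> 0 < g a x u u]) /\
  (forall a b x, chart_image a (dom b) x -> forall u v,
    g a x u v = g b (transition a b x)
      ('D_u (transition a b) x) ('D_v (transition a b) x)).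

Definition fundamental_form (om : local_expr 2) : Prop :=
  is_form setT om /\ exists2 g, hermitian_metric g &
    forall a x, chart_image a setT x -> forall v,
      om a x v = g a x (J (v ord0)) (v ord_max).

Definition lee_form (om : local_expr 2) (eta : local_expr 1) : Prop :=
  closed_form setT eta /\ form_eq setT (dform om) (wedge1 eta om).

Definition lck_form (om : local_expr 2) : Prop :=
  fundamental_form om /\ exists eta, lee_form om eta.

End Forms.

Arguments zerof {R n X k}.

Section FlatLineBundles.
Variables (R : realType) (n : nat) (X : complex_manifold R n).

Definition locally_constant_on (W : set X) (f : X -> R) : Prop :=
  forall p, W p -> \forall q \near p, f q = f p.

(* A real flat line bundle as a locally constant cocycle: a section is a
   family of functions s_i on U_i with s_i = g_ij s_j. *)
Record flat_line_bundle := FlatLineBundle {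
  idx : Type ;
  cov : idx -> set X ;
  cocycle : idx -> idx -> X -> R ;
  cov_open : forall i, open (cov i) ;
  cov_cover : forall p, exists i, cov i p ;
  cocycle_constant :
    forall i j, locally_constant_on (cov i `&` cov j) (cocycle i j) ;
  cocycle_neq0 : forall i j p, cov i p -> cov j p -> cocycle i j p != 0 ;
  cocycleM : forall i j k p, cov i p -> cov j p -> cov k p ->
    cocycle i j p * cocycle j k p = cocycle i k p
}.

(* Equality of the classes of the two cocycles in the first Cech cohomology
   group of X with values in R^*. *)
Definition flat_iso (L L' : flat_line_bundle) : Prop :=
  exists h : idx L -> idx L' -> X -> R,
    [/\ forall i a, locally_constant_on (cov i `&` cov a) (h i a),
        forall i a p, cov i p -> cov a p -> h i a p != 0
      & forall i j a b p, cov i p -> cov j p -> cov a p -> cov b p ->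
          h i a p * cocycle a b p = cocycle i j p * h j b p].

Definition acyclic (W : set X) : Prop :=
  forall k (al : local_expr X k.+1), closed_form W al ->
    exists2 be : local_expr X k, is_form W be & form_eq W (dform be) al.

Definition good_cover (I : Type) (U : I -> set X) : Prop :=
  forall F : set I, finite_set F -> F !=set0 -> acyclic (\bigcap_(i in F) U i).

(* L is the flat line bundle constructed from the Lee form eta and the local
   primitives f of eta. *)
Definition lee_bundle (eta : local_expr X 1) (L : flat_line_bundle)
    (f : idx L -> X -> R) : Prop :=
  [/\ good_cover (@cov L),
      forall i, smooth_function (cov i) (f i),
      forall i, form_eq (cov i) eta (dform (form0 (f i)))
    & forall i j p, cov i p -> cov j p ->
        cocycle i j p = expR (- (f i p - f j p))].

Definition corresponding_bundle (om : local_expr X 2) (N : flat_line_bundle) :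
    Prop :=
  exists eta L (f : idx L -> X -> R),
    [/\ lee_form om eta, lee_bundle eta f & flat_iso L N].

Definition bundle_form (L : flat_line_bundle) (W : set X) k
    (al : idx L -> local_expr X k) : Prop :=
  (forall i, is_form (cov i `&` W) (al i)) /\
  (forall i j, form_eq (cov i `&` cov j `&` W)
                 (al i) (mulf (cocycle i j) (al j))).

Definition d_bundle (L : flat_line_bundle) k (al : idx L -> local_expr X k) :
    idx L -> local_expr X k.+1 :=
  fun i => dform (al i).

Definition bundle_form_eq (L : flat_line_bundle) (W : set X) k
    (al be : idx L -> local_expr X k) : Prop :=
  forall i, form_eq (cov i `&` W) (al i) (be i).

Definition cohomology_class_eq0 (L : flat_line_bundle) k
    (al : idx L -> local_expr X k.+1) : Prop :=
  exists2 be : idx L -> local_expr X k,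
    bundle_form setT be & bundle_form_eq setT (d_bundle be) al.

(* The map {e^{- f_i} al} from ordinary forms to L-valued forms. *)
Definition twist (L : flat_line_bundle) (f : idx L -> X -> R) k
    (al : local_expr X k) : idx L -> local_expr X k :=
  fun i => mulf (fun p => expR (- f i p)) al.

Definition section0 (L : flat_line_bundle) (s : idx L -> X -> R) :
    idx L -> local_expr X 0 :=
  fun i => form0 (s i).

Definition is_section (L : flat_line_bundle) (W : set X)
    (s : idx L -> X -> R) : Prop :=
  bundle_form W (section0 s).

Definition flat_section (L : flat_line_bundle) (W : set X)
    (s : idx L -> X -> R) : Prop :=
  is_section W s /\ forall i, locally_constant_on (cov i `&` W) (s i).

Definition d_bundle_plus (L : flat_line_bundle) (th : local_expr X 1) k
    (al : idx L -> local_expr X k) : idx L -> local_expr X k.+1 :=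
  fun i => addf (d_bundle al i) (wedge1 th (al i)).

(* N is the flat line bundle whose flat sections are the sections s of L with
   (d_L + th) s = 0.  The map h is an isomorphism of smooth (not necessarily
   flat) line bundles from N to L; it takes the section t of N to the section
   s of L with s_i = h_ia t_a. *)
Definition deformed_bundle (L : flat_line_bundle) (th : local_expr X 1)
    (N : flat_line_bundle) : Prop :=
  exists h : idx L -> idx N -> X -> R,
    [/\ forall i a, smooth_function (cov i `&` cov a) (h i a),
        forall i a p, cov i p -> cov a p -> h i a p != 0,
        forall i j a b p, cov i p -> cov j p -> cov a p -> cov b p ->
          h i a p * cocycle a b p = cocycle i j p * h j b p
      & forall (W : set X) (s : idx L -> X -> R) (t : idx N -> X -> R),
          open W -> is_section W s -> is_section W t ->
          (forall i a p, cov i p -> cov a p -> W p ->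
             s i p = h i a p * t a p) ->
          flat_section W t <->
          bundle_form_eq W (d_bundle_plus th (section0 s)) (fun=> zerof)].

End FlatLineBundles.

(* Main.v *)
Require Import Defs.
From HB Require Import structures.
From mathcomp Require Import all_boot all_order all_algebra.
From mathcomp Require Import all_classical all_reals all_analysis.
From mathcomp Require Import perm ring lra.
Import Order.TTheory GRing.Theory Num.Theory.
Import numFieldNormedType.Exports.
(* Gives back to coord and addf their meaning for manifolds and forms. *)
Import Defs.
Local Open Scope classical_set_scope.
Local Open Scope ring_scope.

Set Implicit Arguments.
Unset Strict Implicit.
Unset Printing Implicit Defensive.

(** Suppose that the family om_s exists and let th_s be the Lee form of om_s.
    The flat bundle of om_s is on the one hand the bundle of the Lee form th_s,
    on the other hand the deformation of L by eta_s; comparing the two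
    descriptions gives, for each s, a function u_s on X with
    th_s = eta - eta_s + d u_s ([lee_forms_cohomologous]).  Writing om', th'
    and eta' for the derivatives of om_s, th_s and eta_s at s = 0, the equation
    d om_s = th_s /\ om_s gives

      d om' = th' /\ om + eta /\ om'.

    If th' = - eta' + d w for some function w, then kappa = w om - om'
    satisfies d kappa - eta /\ kappa = eta' /\ om, so that the class of
    eta' /\ om vanishes ([twist_primitive] translates this to forms with values
    in L).

    Two facts have to be supplied.  First, th_s is differentiable in s.  In
    complex dimension n >= 2 this holds because th_s is, up to the factor
    2 n - 2, the trace of d om_s with respect to om_s ([symplectic_traceE],
    [lee_form_family]).  For n <= 1 there is nothing to prove, since X has no
    nonzero 3-forms ([wedge1_dim_le1]).

    Second, the derivative at 0 of beta_s = th_s + eta_s is exact.  This is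
    not immediate from beta_s - beta_0 = d u_s, because the functions u_s are
    found one s at a time and need not be regular in s.  But the derivative is
    a closed form, because d commutes with the derivative in s ([dform_dot0],
    from the symmetry [schwarz] of mixed derivatives), so on each member of the
    good cover it has a primitive G.  By the mean value theorem,
    (u_s p - u_s q) / s tends to G p - G q for nearby points p and q
    ([limit_of_primitives]), and normalizing u_s / s at one point of each
    class of points for which such limits exist produces a global function w
    ([glue_limits], [family_potential]). *)

(** * Calculus of smooth functions on open sets *)

Lemma derive_line (R : realType) (V W : normedModType R) (f : V -> W) x v :
  'D_v f x = 'D_1 (fun h : R => f (h *: v + x)) 0.
Proof.
rewrite /derive; set g1 := fun h => h^-1 *: _; set g2 := fun h => h^-1 *: _.
suff -> : g1 = g2 by [].
by rewrite funeqE /g1 /g2 => h /=; rewrite addr0 scale0r add0r [_%:A]mulr1.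
Qed.

Lemma is_derive_line (R : realType) (V W : normedModType R) (f : V -> W)
    x v (t : R) df :
  is_derive (t *: v + x) v f df ->
  is_derive t (1 : R) (fun h : R => f (h *: v + x)) df.
Proof.
move=> [fd fv].
have e : (fun h : R => h^-1 *: (((fun h => f (h *: v + x)) \o shift t)
      (h *: (1 : R)) - f (t *: v + x))) =
    (fun h : R => h^-1 *: ((f \o shift (t *: v + x)) (h *: v)
      - f (t *: v + x))).
  by rewrite funeqE => h /=; rewrite [_%:A]mulr1 scalerDl addrA.
by split; rewrite /derivable /derive e.
Qed.

Lemma is_derive_comp1 (R : realType) (V : normedModType R) (phi : R -> R)
    (f : V -> R) x v (dphi df : R) :
  is_derive (f x) (1 : R) phi dphi -> is_derive x v f df ->
  is_derive x v (phi \o f) (dphi * df).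
Proof.
move=> [p1 p2] [f1 f2].
have q1 : derivable (fun h : R => f (h *: v + x)) 0 1
  by exact: (derivable1P f x v).1 f1.
have q2 : derivable phi ((fun h : R => f (h *: v + x)) 0) 1.
  by rewrite /= scale0r add0r; exact: p1.
split.
  apply/derivable1P; apply: (derivable1_diffP _ _).2.
  apply: (@differentiable_comp _ _ _ _ (fun h : R => f (h *: v + x)) phi).
    exact: (derivable1_diffP _ _).1 q1.
  exact: (derivable1_diffP _ _).1 q2.
rewrite derive_line -derive1E (derive1_comp q1 q2) !derive1E -derive_line f2.
by rewrite scale0r add0r p2.
Qed.

Lemma near_eq_continuous (R : realType) (V W : normedModType R) (f g : V -> W)
    (x : V) :
  {near x, f =1 g} -> {for x, continuous f} -> {for x, continuous g}.
Proof.
move=> fg; have e : f x = g x := nbhs_singleton fg.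
rewrite /prop_for /continuous_at -e => fc; apply: cvg_trans fc.
exact: near_eq_cvg.
Qed.

Lemma near_iter_derive (R : realType) (V W : normedModType R) (f g : V -> W)
    (x : V) (vs : seq V) :
  {near x, f =1 g} -> {near x, iter_derive f vs =1 iter_derive g vs}.
Proof.
elim: vs => [//|v vs IH] /IH {IH} /nbhs_interior fg /=.
apply: filterS fg => y fg; exact: near_eq_derive.
Qed.

Lemma iter_derive_rcons (R : realType) (V W : normedModType R) (f : V -> W)
    (vs : seq V) v :
  iter_derive f (rcons vs v) = iter_derive ('D_v f) vs.
Proof. by rewrite /iter_derive foldr_rcons. Qed.

(** Words of directions, as in [iter_derive], give no induction for products.
    Counting the order instead lets one induct on it for all functions at
    once: the derivative of a product, an inverse or an exponential is built
    from functions of one order less. *)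
Fixpoint Ck_on (R : realType) (V W : normedModType R) (k : nat) (A : set V)
    (f : V -> W) : Prop :=
  (forall x, A x -> {for x, continuous f}) /\
  if k is k'.+1 then
    forall v, (forall x, A x -> derivable f x v) /\ Ck_on k' A ('D_v f)
  else True.

Lemma Ck_onS (R : realType) (V W : normedModType R) k (A : set V)
  (f : V -> W) : Ck_on k.+1 A f -> Ck_on k A f.
Proof.
elim: k f => [|k IH] f [fc fd]; split => // v.
by split; [exact: (fd v).1|apply: IH; exact: (fd v).2].
Qed.

(** The last letter of the word is the first derivative taken, so peeling words
    from the right turns iterated derivatives of [f] into those of ['D_v f]. *)
Lemma smooth_onP (R : realType) (V W : normedModType R) (A : set V)
    (f : V -> W) : smooth_on A f <-> forall k, Ck_on k A f.
Proof.
split=> [fs k|fC vs x Ax].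
  elim: k f fs => [|k IH] f fs; split=> //.
  - by move=> x Ax; have [] := fs [::] x Ax.
  - by move=> x Ax; have [] := fs [::] x Ax.
  - move=> v; split; first by move=> x Ax; have [_ /(_ v)] := fs [::] x Ax.
    by apply: IH => vs x Ax; rewrite -iter_derive_rcons; exact: fs.
suff [] : Ck_on 1 A (iter_derive f vs).
  by move=> c d; split; [exact: c|move=> v; exact: (d v).1].
have {fC} : Ck_on (size vs).+1 A f by [].
elim/last_ind: vs f => // vs v IH f; rewrite size_rcons => -[_ fd].
by rewrite iter_derive_rcons; apply: IH; exact: (fd v).2.
Qed.

Lemma smooth_on_near (R : realType) (V W : normedModType R) (A : set V)
    (f g : V -> W) :
  (forall x, A x -> {near x, f =1 g}) -> smooth_on A f -> smooth_on A g.
Proof.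
move=> fg fs vs x Ax; have [fc fd] := fs vs x Ax.
have e := near_iter_derive vs (fg x Ax); split.
  exact: near_eq_continuous fc.
by move=> v; exact: near_eq_derivable (fd v).
Qed.

Lemma smooth_on_ext (R : realType) (V W : normedModType R) (A : set V)
    (f g : V -> W) : open A ->
  (forall x, A x -> f x = g x) -> smooth_on A f -> smooth_on A g.
Proof.
move=> oA fg; apply: smooth_on_near => x Ax.
by apply: filterS (open_nbhs_nbhs (conj oA Ax)) => y; exact: fg.
Qed.

Lemma Ck_on_ext (R : realType) (V W : normedModType R) k (A : set V)
    (f g : V -> W) : open A ->
  (forall x, A x -> f x = g x) -> Ck_on k A f -> Ck_on k A g.
Proof.
move=> oA; elim: k f g => [|k IH] f g fg [fc fd].
all: have e x : A x -> {near x, f =1 g}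
  by move=> Ax; apply: filterS (open_nbhs_nbhs (conj oA Ax)) => y; exact: fg.
all: have gc x (Ax : A x) : {for x, continuous g}
  := near_eq_continuous (e _ Ax) (fc _ Ax).
  by split.
split=> // v; split.
  by move=> x Ax; exact: near_eq_derivable (e _ Ax) ((fd v).1 _ Ax).
by apply: IH (fd v).2 => x Ax; apply: near_eq_derive; exact: e.
Qed.

Lemma smooth_onS (R : realType) (V W : normedModType R) (A B : set V)
    (f : V -> W) : A `<=` B -> smooth_on B f -> smooth_on A f.
Proof. by move=> AB fs vs x /AB; exact: fs. Qed.

Lemma smooth_on_derivable (R : realType) (V W : normedModType R) (A : set V)
    (f : V -> W) x v : smooth_on A f -> A x -> derivable f x v.
Proof. by move=> fs Ax; exact: (fs [::] x Ax).2. Qed.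

Lemma smooth_on_continuous (R : realType) (V W : normedModType R) (A : set V)
    (f : V -> W) x : smooth_on A f -> A x -> {for x, continuous f}.
Proof. by move=> fs Ax; exact: (fs [::] x Ax).1. Qed.

Lemma smooth_on_derive (R : realType) (V W : normedModType R) (A : set V)
    (f : V -> W) v : smooth_on A f -> smooth_on A ('D_v f).
Proof. by move=> fs vs x Ax; rewrite -iter_derive_rcons; exact: fs. Qed.

Lemma Ck_on_cst (R : realType) (V W : normedModType R) k (A : set V) (c : W) :
  Ck_on k A (fun _ : V => c).
Proof.
elim: k c => [|k IH] c; split=> //; try by move=> x _; exact: cvg_cst.
move=> v; split; first by move=> x _; exact: derivable_cst.
suff -> : 'D_v (fun _ : V => c) = (fun=> 0) by exact: IH.
by rewrite funeqE => x; exact: derive_cst.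
Qed.

Lemma Ck_onD (R : realType) (V W : normedModType R) k (A : set V)
    (f g : V -> W) : open A -> Ck_on k A f -> Ck_on k A g ->
  Ck_on k A (fun x => f x + g x).
Proof.
move=> oA; elim: k f g => [|k IH] f g [fc fd] [gc gd]; split=> //.
- by move=> x Ax; apply: cvgD; [exact: fc|exact: gc].
- by move=> x Ax; apply: cvgD; [exact: fc|exact: gc].
- move=> v; split.
    by move=> x Ax; apply: derivableD; [exact: (fd v).1|exact: (gd v).1].
  apply: Ck_on_ext (IH _ _ (fd v).2 (gd v).2) => // x Ax.
  by rewrite -deriveD //; [exact: (fd v).1|exact: (gd v).1].
Qed.

Lemma Ck_onM (R : realType) (V : normedModType R) k (A : set V)
    (f g : V -> R) : open A -> Ck_on k A f -> Ck_on k A g ->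
  Ck_on k A (fun x => f x * g x).
Proof.
move=> oA; elim: k f g => [|k IH] f g fk gk.
all: have [fc fd] := fk; have [gc gd] := gk; split=> //.
- by move=> x Ax; apply: cvgM; [exact: fc|exact: gc].
- by move=> x Ax; apply: cvgM; [exact: fc|exact: gc].
- move=> v; split.
    by move=> x Ax; apply: derivableM; [exact: (fd v).1|exact: (gd v).1].
  have := Ck_onD oA (IH _ _ (Ck_onS fk) (gd v).2) (IH _ _ (Ck_onS gk) (fd v).2).
  apply: Ck_on_ext => // x Ax.
  by rewrite [RHS]deriveM //; [exact: (fd v).1|exact: (gd v).1].
Qed.

(** The derivative - f^-2 D f involves the inverse itself, at the lower order
    already covered by the induction. *)
Lemma Ck_onV (R : realType) (V : normedModType R) k (A : set V)
    (f : V -> R) : open A -> (forall x, A x -> f x != 0) -> Ck_on k A f ->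
  Ck_on k A (fun x => (f x)^-1).
Proof.
move=> oA f0; elim: k f f0 => [|k IH] f f0 fk; have [fc fd] := fk; split=> //.
- by move=> x Ax; apply: cvgV; [exact: f0|exact: fc].
- by move=> x Ax; apply: cvgV; [exact: f0|exact: fc].
- move=> v; split.
    by move=> x Ax; apply: derivableV; [exact: f0|exact: (fd v).1].
  have i := IH _ f0 (Ck_onS fk).
  have j := Ck_onM oA (Ck_onM oA i i) (fd v).2.
  have := Ck_onM oA (Ck_on_cst k A (-1 : R)) j.
  apply: Ck_on_ext => // x Ax; rewrite deriveV ?f0 //; last exact: (fd v).1.
  by rewrite mulN1r expr2 invfM /GRing.scale /= mulNr.
Qed.

Lemma Ck_on_expR (R : realType) (V : normedModType R) k (A : set V)
    (f : V -> R) : open A -> Ck_on k A f -> Ck_on k A (fun x => expR (f x)).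
Proof.
move=> oA; elim: k f => [|k IH] f fk; have [fc fd] := fk; split=> //.
- by move=> x Ax; apply: continuous_comp; [exact: fc|exact: continuous_expR].
- by move=> x Ax; apply: continuous_comp; [exact: fc|exact: continuous_expR].
- move=> v.
  have ed x : A x ->
      is_derive x v (fun x => expR (f x)) (expR (f x) * 'D_v f x).
    move=> Ax; apply: is_derive_comp1; exact/derivableP/(fd v).1.
  split; first by move=> x /ed [].
  apply: Ck_on_ext (Ck_onM oA (IH _ (Ck_onS fk)) (fd v).2) => //.
  by move=> x /ed [_ ->].
Qed.

Lemma smooth_on_cst (R : realType) (V W : normedModType R) (A : set V)
  (c : W) : smooth_on A (fun _ : V => c).
Proof. by apply/smooth_onP => k; exact: Ck_on_cst. Qed.

Lemma smooth_onD (R : realType) (V W : normedModType R) (A : set V)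
    (f g : V -> W) : open A -> smooth_on A f -> smooth_on A g ->
  smooth_on A (fun x => f x + g x).
Proof.
move=> oA /smooth_onP fs /smooth_onP gs; apply/smooth_onP => k.
exact: Ck_onD.
Qed.

Lemma smooth_onM (R : realType) (V : normedModType R) (A : set V)
    (f g : V -> R) : open A -> smooth_on A f -> smooth_on A g ->
  smooth_on A (fun x => f x * g x).
Proof.
move=> oA /smooth_onP fs /smooth_onP gs; apply/smooth_onP => k.
exact: Ck_onM.
Qed.

Lemma smooth_onN (R : realType) (V : normedModType R) (A : set V)
    (f : V -> R) : open A -> smooth_on A f -> smooth_on A (fun x => - f x).
Proof.
move=> oA fs; have := smooth_onM oA (@smooth_on_cst _ _ _ A (-1 : R)) fs.
by apply: smooth_on_ext => // x _; rewrite mulN1r.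
Qed.

Lemma smooth_onV (R : realType) (V : normedModType R) (A : set V)
    (f : V -> R) : open A -> (forall x, A x -> f x != 0) -> smooth_on A f ->
  smooth_on A (fun x => (f x)^-1).
Proof.
by move=> oA f0 /smooth_onP fs; apply/smooth_onP => k; exact: Ck_onV.
Qed.

Lemma smooth_on_expR (R : realType) (V : normedModType R) (A : set V)
    (f : V -> R) : open A -> smooth_on A f ->
  smooth_on A (fun x => expR (f x)).
Proof.
by move=> oA /smooth_onP fs; apply/smooth_onP => k; exact: Ck_on_expR.
Qed.

Lemma smooth_on_sum (R : realType) (V : normedModType R) (A : set V)
    (I : finType) (f : I -> V -> R) : open A ->
  (forall i, smooth_on A (f i)) -> smooth_on A (fun x => \sum_i f i x).
Proof.
move=> oA fs; elim: (index_enum I) => [|i r IH].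
  by under eq_fun do rewrite big_nil; exact: smooth_on_cst.
under eq_fun do rewrite big_cons.
exact: smooth_onD oA (fs i) IH.
Qed.

Lemma smooth_on_prod (R : realType) (V : normedModType R) (A : set V)
    (I : finType) (f : I -> V -> R) : open A ->
  (forall i, smooth_on A (f i)) -> smooth_on A (fun x => \prod_i f i x).
Proof.
move=> oA fs; elim: (index_enum I) => [|i r IH].
  by under eq_fun do rewrite big_nil; exact: smooth_on_cst.
under eq_fun do rewrite big_cons.
exact: smooth_onM oA (fs i) IH.
Qed.

Lemma smooth_on_det (R : realType) (V : normedModType R) (A : set V) (m : nat)
    (M : V -> 'M[R]_m) : open A ->
  (forall i j, smooth_on A (fun x => M x i j)) ->
  smooth_on A (fun x => \det (M x)).
Proof.
move=> oA Ms; rewrite /determinant.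
apply: (@smooth_on_sum _ _ _ _
  (fun (s : 'S_m) x => (-1) ^+ s * \prod_i M x i (s i)) oA) => s.
apply: (smooth_onM oA); first exact: smooth_on_cst.
apply: (@smooth_on_prod _ _ _ _ (fun i x => M x i (s i)) oA) => i.
exact: Ms.
Qed.

(** Cramer's formula: the entries are cofactors over the determinant, hence
    rational in the entries of the matrix. *)
Lemma smooth_on_invmx (R : realType) (V : normedModType R) (A : set V)
    (m : nat) (M : V -> 'M[R]_m) i j : open A ->
  (forall x, A x -> M x \in unitmx) ->
  (forall i j, smooth_on A (fun x => M x i j)) ->
  smooth_on A (fun x => invmx (M x) i j).
Proof.
move=> oA Mu Ms.
apply: (@smooth_on_ext _ _ _ _
  (fun x => (\det (M x))^-1 * cofactor (M x) j i) _ oA).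
  by move=> x Ax; rewrite /invmx Mu // !mxE.
apply: (smooth_onM oA).
  apply: (smooth_onV oA); last exact: smooth_on_det.
  by move=> x Ax; rewrite -unitfE -unitmxE; exact: Mu.
apply: (smooth_onM oA); first exact: smooth_on_cst.
apply: (smooth_on_det oA) => k l.
by apply: (smooth_on_ext oA _ (Ms (lift j k) (lift i l))) => x _; rewrite !mxE.
Qed.

(** * Mean values, mixed derivatives and dependence on a parameter *)

(** The classical theorem on the segment from [x] to [h *: v + x]; [h] may have
    either sign, which is why the intermediate point is located by norms. *)
Lemma mean_value (R : realType) (V : normedModType R) (f : V -> R) x v
    (h : R) :
  (forall t : R, `|t| <= `|h| -> derivable f (t *: v + x) v) ->
  exists2 c : R, `|c| <= `|h| & f (h *: v + x) - f x = h * 'D_v f (c *: v + x).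
Proof.
move=> fd; pose g (t : R) := f (t *: v + x).
have gd (t : R) : `|t| <= `|h| -> is_derive t (1 : R) g ('D_v f (t *: v + x)).
  by move=> th; apply: is_derive_line; apply: derivableP; exact: fd.
have g0 : g 0 = f x by rewrite /g scale0r add0r.
have [h0|h0] := leP 0 h.
  have sub (t : R) : t \in `[0, h] -> `|t| <= `|h|.
    by rewrite in_itv /= => /andP[t0 th]; rewrite !ger0_norm.
  have [||c c0h E] := @MVT_segment R g (fun t => 'D_v f (t *: v + x)) 0 h h0.
  - by move=> t t0h; apply: gd; apply: sub; exact: subset_itv_oo_cc t0h.
  - apply: derivable_within_continuous => t t0h.
    by have [] := gd t (sub t t0h).
  - exists c; first exact: sub.
    by move: E; rewrite g0 subr0 mulrC.
have sub (t : R) : t \in `[h, 0] -> `|t| <= `|h|.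
  rewrite in_itv /= => /andP[th t0].
  by rewrite !ler0_norm ?lerN2 // ltW.
have [||c c0h E] :=
  @MVT_segment R g (fun t => 'D_v f (t *: v + x)) h 0 (ltW h0).
- by move=> t t0h; apply: gd; apply: sub; exact: subset_itv_oo_cc t0h.
- apply: derivable_within_continuous => t t0h.
  by have [] := gd t (sub t t0h).
- exists c; first exact: sub.
  move: E; rewrite g0 sub0r mulrN mulrC => E.
  by rewrite -[LHS]opprB E opprK.
Qed.

Lemma is_derive_translate (R : realType) (V W : normedModType R) (f : V -> W)
    (w x v : V) df :
  is_derive (w + x) v f df -> is_derive x v (fun y => f (w + y)) df.
Proof.
move=> [fd fv].
have e : (fun h : R => h^-1 *: (((fun y => f (w + y)) \o shift x) (h *: v)
     - f (w + x))) =
    (fun h : R => h^-1 *: ((f \o shift (w + x)) (h *: v) - f (w + x))).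
  by rewrite funeqE => h /=; rewrite addrCA.
by split; rewrite /derivable /derive e.
Qed.

Lemma near_parallelogram (R : realType) (V : normedModType R) (x u v : V)
    (P : V -> Prop) : (\forall y \near x, P y) ->
  exists2 h : R, 0 < h & forall s t : R, `|s| <= h -> `|t| <= h ->
    P (s *: u + (t *: v + x)).
Proof.
move=> /nbhs_ballP[r /= r0 rP].
have m0 : 0 < `|u| + `|v| + 1 by rewrite ltr_wpDl // addr_ge0.
exists (r / (`|u| + `|v| + 1) / 2); first by rewrite !divr_gt0.
move=> s t sh th; apply: rP; rewrite -ball_normE /=.
rewrite distrC addrA addrK; apply: le_lt_trans (ler_normD _ _) _.
rewrite !normrZ.
have h0 : 0 <= r / (`|u| + `|v| + 1) / 2 by rewrite !divr_ge0 // ltW.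
apply: (@le_lt_trans _ _
  (r / (`|u| + `|v| + 1) / 2 * `|u| + r / (`|u| + `|v| + 1) / 2 * `|v|)).
  by apply: lerD; apply: ler_wpM2r.
have e : r = r / (`|u| + `|v| + 1) * (`|u| + `|v| + 1).
  by rewrite divfK // gt_eqF.
rewrite -mulrDr [X in _ < X]e.
have r1 : 0 < r / (`|u| + `|v| + 1) by rewrite divr_gt0.
rewrite -mulrA ltr_pM2l //.
have : 0 <= `|u| + `|v| by rewrite addr_ge0.
lra.
Qed.

(** The mean value theorem used twice: in the direction [u] for the increment
    of [f] along [v], and then in the direction [v] for ['D_u f]. *)
Lemma second_difference (R : realType) (V : normedModType R) (A : set V)
    (f : V -> R) x u v (h : R) : smooth_on A f ->
  (forall s t : R, `|s| <= `|h| -> `|t| <= `|h| ->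
    A (s *: v + (t *: u + x))) ->
  exists s t : R, [/\ `|s| <= `|h|, `|t| <= `|h| &
    f (h *: v + (h *: u + x)) - f (h *: u + x) - (f (h *: v + x) - f x) =
    h * (h * 'D_v ('D_u f) (s *: v + (t *: u + x)))].
Proof.
move=> fs Ah.
have n0 : `|0 : R| <= `|h| by rewrite normr0.
have d (s t : R) w : `|s| <= `|h| -> `|t| <= `|h| ->
    is_derive (s *: v + (t *: u + x)) w f ('D_w f (s *: v + (t *: u + x))).
  move=> sh th; apply: derivableP.
  exact: (smooth_on_derivable fs (Ah _ _ sh th)).
have d0 (t : R) w : `|t| <= `|h| ->
    is_derive (t *: u + x) w f ('D_w f (t *: u + x)).
  by move=> th; have := d 0 t w n0 th; rewrite scale0r add0r.
pose g y := f (h *: v + y) - f y.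
have gd (t : R) : `|t| <= `|h| -> is_derive (t *: u + x) u g
    ('D_u f (h *: v + (t *: u + x)) - 'D_u f (t *: u + x)).
  move=> th; apply: is_deriveB; last exact: d0.
  apply: is_derive_translate; exact: d.
have [t th|t th Et] := @mean_value R V g x u h; first by have [] := gd t th.
have [s sh|s sh Es] := @mean_value R V ('D_u f) (t *: u + x) v h.
  exact: (smooth_on_derivable (smooth_on_derive u fs) (Ah _ _ sh th)).
exists s, t; split=> //.
rewrite -Es.
have [_ Eg] := gd t th.
by rewrite -Eg -Et.
Qed.

(** Both mixed derivatives, at suitable points, equal the same second
    difference divided by h ^ 2. *)
Lemma mixed_quotients_close (R : realType) (h e a1 a2 a3 a4 p q X Y : R) :
  h != 0 ->
  a1 - a2 - (a3 - a4) = h * (h * p) -> a1 - a3 - (a2 - a4) = h * (h * q) ->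
  `|X - p| < e / 2 -> `|Y - q| < e / 2 -> `|X - Y| < e.
Proof.
move=> h0 Ep Eq Xp Yq.
have E : p = q by apply: (mulfI h0); apply: (mulfI h0); rewrite -Ep -Eq; ring.
have -> : X - Y = (X - p) - (Y - q) by rewrite E; ring.
by rewrite (splitr e); apply: le_lt_trans (ler_normB _ _) _; exact: ltrD.
Qed.

(** The second difference over the parallelogram of [h *: u] and [h *: v] is
    symmetric in [u] and [v], and divided by [h ^ 2] it is a value near [x] of
    either mixed derivative.  Both being continuous, they agree at [x]. *)
Lemma schwarz (R : realType) (V : normedModType R) (A : set V) (f : V -> R)
    x u v : open A -> smooth_on A f -> A x ->
  'D_u ('D_v f) x = 'D_v ('D_u f) x.
Proof.
move=> oA fs Ax; apply/eqP; rewrite -subr_eq0; apply/negPn/negP => ne.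
pose e := `|'D_u ('D_v f) x - 'D_v ('D_u f) x|.
have e0 : 0 < e by rewrite normr_gt0.
have e2 : 0 < e / 2 by rewrite divr_gt0.
have c w w' : {for x, continuous ('D_w ('D_w' f))}.
  exact: smooth_on_continuous (smooth_on_derive _ (smooth_on_derive _ fs)) Ax.
have N w w' : \forall y \near x,
    `|'D_w ('D_w' f) x - 'D_w ('D_w' f) y| < e / 2.
  by have /cvgrPdist_lt := c w w'; apply.
have NA : \forall y \near x, A y by exact: open_nbhs_nbhs.
have NP : \forall y \near x, [/\ A y,
    `|'D_u ('D_v f) x - 'D_u ('D_v f) y| < e / 2 &
    `|'D_v ('D_u f) x - 'D_v ('D_u f) y| < e / 2].
  by apply: filterS (filterI NA (filterI (N u v) (N v u))) => y [? []].
have [h h0 hP] := near_parallelogram u v NP.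
have hh : `|h| = h by rewrite gtr0_norm.
have [|s [t [sh th E1]]] := @second_difference R V A f x v u h fs.
  by rewrite hh => s t sh th; have [] := hP s t sh th.
have [|s' [t' [sh' th' E2]]] := @second_difference R V A f x u v h fs.
  by rewrite hh => s' t' sh' th'; rewrite addrCA; have [] := hP t' s' th' sh'.
move: sh th sh' th'; rewrite hh => sh th sh' th'.
have [_ b1 _] := hP s t sh th.
have [_ _ b2] := hP t' s' th' sh'.
have ec : h *: v + (h *: u + x) = h *: u + (h *: v + x) := addrCA _ _ _.
have ec' : t' *: u + (s' *: v + x) = s' *: v + (t' *: u + x) := addrCA _ _ _.
rewrite ec in E2; rewrite ec' in b2.
have := mixed_quotients_close (lt0r_neq0 h0) E1 E2 b1 b2.
by rewrite ltxx.
Qed.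

Lemma pair_line (R : realType) (V : normedModType R) (h a s : R) (v x : V) :
  h *: (a, v) + (s, x) = (h * a + s, h *: v + x) :> R * V.
Proof. by []. Qed.

Lemma derive_pair2 (R : realType) (V W : normedModType R) (F : R * V -> W)
    s x v :
  'D_v (fun y => F (s, y)) x = 'D_((0 : R), v) F (s, x).
Proof.
rewrite /derive; set g1 := fun h => h^-1 *: _; set g2 := fun h => h^-1 *: _.
suff -> : g1 = g2 by [].
rewrite funeqE /g1 /g2 => h /=; congr (_ *: (F _ - _)).
by rewrite pair_line mulr0 add0r.
Qed.

Lemma is_derive_pair1 (R : realType) (V W : normedModType R) (F : R * V -> W)
    (s : R) x : derivable F (s, x) (1, 0) -> 
  is_derive s (1 : R) (fun t => F (t, x)) ('D_((1 : R), 0) F (s, x)).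
Proof.
move=> dF.
have E : (fun h : R => h^-1 *: (((fun t => F (t, x)) \o shift s) (h *: (1 : R))
            - F (s, x))) =
    (fun h : R => h^-1 *: ((F \o shift (s, x)) (h *: ((1 : R), (0 : V)))
            - F (s, x))).
  rewrite funeqE => h /=; congr (_ *: (F _ - _)).
  by rewrite pair_line scaler0 add0r.
by split; rewrite /derivable /derive E.
Qed.

Lemma smooth_on_slice (R : realType) (V W : normedModType R) (A : set (R * V))
    (F : R * V -> W) (s : R) :
  smooth_on A F -> smooth_on [set y | A (s, y)] (fun y => F (s, y)).
Proof.
move=> Fs.
have E vs : iter_derive (fun y => F (s, y)) vs =
    fun y => iter_derive F [seq ((0 : R), v) | v <- vs] (s, y).
  elim: vs => [//|v vs IH]; rewrite /= IH funeqE => y; exact: derive_pair2.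
move=> vs x Ax; rewrite E.
have [Fc Fd] := Fs [seq ((0 : R), v) | v <- vs] (s, x) Ax; split.
  have pc : {for x, continuous (fun y : V => (s, y))}.
    by apply: (@cvg_pair _ _ _ _ (nbhs s)); [exact: cvg_cst|exact: cvg_id].
  exact: continuous_comp pc Fc.
move=> v.
have := Fd ((0 : R), v).
rewrite /derivable; set g1 := fun h => h^-1 *: _; set g2 := fun h => h^-1 *: _.
suff -> : g1 = g2 by [].
rewrite funeqE /g1 /g2 => h /=; congr (_ *: (iter_derive F _ _ - _)).
by rewrite pair_line mulr0 add0r.
Qed.

(** The quotient is a value of the partial derivative in the parameter at a
    nearby parameter, by the mean value theorem; compactness of the segment
    makes the continuity of that derivative uniform along it. *)
Lemma difference_quotient_uniform (R : realType) (V : normedModType R)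
    (A : set (R * V)) (F : R * V -> R) (x y : V) : open A -> smooth_on A F ->
  (forall t : R, `|t| <= 1 -> A (0, t *: y + x)) ->
  forall e : R, 0 < e -> \forall s \near (0 : R)^', forall t : R, `|t| <= 1 ->
    `|s^-1 * (F (s, t *: y + x) - F (0, t *: y + x)) -
      'D_((1 : R), 0) F (0, t *: y + x)| <= e.
Proof.
move=> oA Fs Ax e e0.
have /compact_near_coveringP nc := @segment_compact R (- 1) 1.
pose P (s t : R) := `|s^-1 * (F (s, t *: y + x) - F (0, t *: y + x)) -
      'D_((1 : R), 0) F (0, t *: y + x)| <= e.
suff : \forall s \near (0 : R)^', `[(-1 : R), 1] `<=` P s.
  by apply: filterS => s sP t t1; apply: sP; rewrite /= in_itv /= -ler_norml.
apply: nc => t0; rewrite /= in_itv /= -ler_norml => t01.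
have e2 : 0 < e / 2 by rewrite divr_gt0.
have dc : {for (0, t0 *: y + x), continuous ('D_((1 : R), 0) F)}.
  exact: smooth_on_continuous (smooth_on_derive _ Fs) (Ax _ t01).
have N : \forall z \near ((0 : R), t0 *: y + x), A z /\
    `|'D_((1 : R), 0) F (0, t0 *: y + x) - 'D_((1 : R), 0) F z| < e / 2.
  apply: filterI; first exact: open_nbhs_nbhs (conj oA (Ax _ t01)).
  by have /cvgrPdist_lt := dc; apply.
have [[B1 B2] /= [B1n B2n] B12] := N.
have Tn : \forall t \near t0, B2 (t *: y + x).
  have : (t *: y + x) @[t --> t0] --> t0 *: y + x.
    by apply: cvgD; [apply: cvgZr_tmp; exact: cvg_id|exact: cvg_cst].
  by apply.
have [r /= r0 rB1] := (nbhs_ballP _ _).1 B1n.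
have Sn : \forall s \near (0 : R)^', `|s| < r /\ s != 0.
  near=> s; split; last by near: s; exact: nbhs_dnbhs_neq.
  by near: s; exact: dnbhs0_lt.
exists ([set t | B2 (t *: y + x)], [set s | `|s| < r /\ s != 0]).
  by split.
move=> [t s] /= [B2t [sr s0]]; rewrite /P.
have B1s (c : R) : `|c| <= `|s| -> B1 c.
  move=> cs; apply: rB1; rewrite -ball_normE /= sub0r normrN.
  exact: le_lt_trans sr.
have L (c : R) : c *: ((1 : R), (0 : V)) + (0, t *: y + x) = (c, t *: y + x).
  by rewrite pair_line mulr1 addr0 scaler0 add0r.
have [c cs|c cs E] := @mean_value R _ F (0, t *: y + x) ((1 : R), 0) s.
  rewrite L; apply: smooth_on_derivable Fs _.
  by have [] := B12 (c, t *: y + x) (conj (B1s _ cs) B2t).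
rewrite !L in E; rewrite E mulKf //.
have [_ d1] := B12 (c, t *: y + x) (conj (B1s _ cs) B2t).
have [] := B12 (0, t *: y + x) (conj (B1s 0 _) B2t).
  by rewrite normr0.
move=> _ d2.
move: ('D__ _ _) ('D__ _ _) ('D__ _ _) d1 d2 => p q o d1 d2.
have -> : q - p = (o - p) - (o - q) by ring.
rewrite (splitr e) ltW //; apply: le_lt_trans (ler_normB _ _) _.
exact: ltrD.
Unshelve. all: by end_near. Qed.

(** If the differential of [u s] is [F s - F 0] along a segment, then the
    increment of [u s] divided by [s] tends to the increment of a primitive [G]
    of the derivative of [F] at 0.  The function [s^-1 * u s - G] has a
    derivative that is uniformly small on the segment, so the mean value
    theorem bounds its increment. *)
Lemma limit_of_primitives (R : realType) (V : normedModType R)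
    (A : set (R * V)) (F : R * V -> R) (G : V -> R) (u : R -> V -> R) (d : R)
    (x y : V) : open A -> smooth_on A F -> 0 < d ->
  (forall t : R, `|t| <= 1 -> A (0, t *: y + x)) ->
  (forall t : R, `|t| <= 1 ->
    is_derive (t *: y + x) y G ('D_((1 : R), 0) F (0, t *: y + x))) ->
  (forall s t : R, `|s| < d -> `|t| <= 1 ->
    is_derive (t *: y + x) y (u s) (F (s, t *: y + x) - F (0, t *: y + x))) ->
  s^-1 * (u s (y + x) - u s x) @[s --> (0 : R)^'] --> G (y + x) - G x.
Proof.
move=> oA Fs d0 Ax Gd ud; apply/cvgrPdist_le => e e0.
have Q := difference_quotient_uniform oA Fs Ax e0.
near=> s.
have sd : `|s| < d by near: s; exact: dnbhs0_lt.
have Qs : forall t : R, `|t| <= 1 ->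
    `|s^-1 * (F (s, t *: y + x) - F (0, t *: y + x)) -
      'D_((1 : R), 0) F (0, t *: y + x)| <= e by near: s.
pose w z := s^-1 * u s z - G z.
have wd (t : R) : `|t| <= 1 -> is_derive (t *: y + x) y w
    (s^-1 * (F (s, t *: y + x) - F (0, t *: y + x)) -
      'D_((1 : R), 0) F (0, t *: y + x)).
  move=> t1; apply: is_deriveB; last exact: Gd.
  exact: is_deriveZ (ud s t sd t1).
have [t|t] := @mean_value R V w x y 1; rewrite normr1 => t1.
  by have [] := wd t t1.
have [_ ->] := wd t t1.
rewrite scale1r mul1r => E; rewrite distrC.
have -> : s^-1 * (u s (y + x) - u s x) - (G (y + x) - G x) = w (y + x) - w x.
  by rewrite /w; ring.
by rewrite E; exact: Qs.
Unshelve. all: by end_near. Qed.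

(** * Differential forms in charts *)

Lemma chart_imageP (R : realType) (n : nat) (X : complex_manifold R n)
    (a : chart X) (W : set X) x :
  chart_image a W x <->
  [/\ dom a (param a x), coord a (param a x) = x & W (param a x)].
Proof.
split=> [[p [ap Wp] <-]|[ax xx Wx]]; first by rewrite coordK.
by exists (param a x).
Qed.

Lemma chart_imageS (R : realType) (n : nat) (X : complex_manifold R n)
    (a : chart X) (U W : set X) : U `<=` W ->
  chart_image a U `<=` chart_image a W.
Proof. by move=> UW x [p [ap /UW Wp] <-]; exists p. Qed.

Lemma chart_image_near (R : realType) (n : nat) (X : complex_manifold R n)
    (a : chart X) (W : set X) x : chart_image a setT x ->
  (\forall p \near param a x, W p) -> \forall y \near x, chart_image a W y.
Proof.
move=> /chart_imageP[ax xx _] WN.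
have xi : (coord a @` dom a) x by exists (param a x).
have N1 := open_nbhs_nbhs (conj (@coord_open _ _ X a) xi).
have N2 : \forall y \near x, W (param a y) := param_continuous xi WN.
apply: filterS (filterI N1 N2) => y [[p ap <-]].
by rewrite coordK // => Wp; exists p.
Qed.

Lemma chart_image_open (R : realType) (n : nat) (X : complex_manifold R n)
    (a : chart X) (W : set X) : open W -> open (chart_image a W).
Proof.
move=> oW; rewrite openE => x ax.
apply: chart_image_near; first exact: chart_imageS ax.
by have /chart_imageP[_ _ Wx] := ax; exact: open_nbhs_nbhs.
Qed.

Lemma transition_param (R : realType) (n : nat) (X : complex_manifold R n)
    (a b : chart X) x : dom b (param a x) ->
  param b (transition a b x) = param a x.
Proof. exact: coordK. Qed.

(** A 0-form has no vector argument to be linear in, and its values on two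
    charts are those of one function on the manifold. *)
Lemma smooth_functionP (R : realType) (n : nat) (X : complex_manifold R n)
    (W : set X) (f : X -> R) :
  smooth_function W f <->
  forall a, smooth_on (chart_image a W) (fun x => f (param a x)).
Proof.
split=> [[fs _ _ _] a|fs]; first exact: fs a (fun=> 0).
split.
- by move=> a v; exact: fs.
- by move=> a x _ v [].
- by move=> a x _ v [].
- move=> a b x /chart_imageP[_ _ [bx _]] v.
  by rewrite /form0 transition_param.
Qed.

Lemma is_formS (R : realType) (n : nat) (X : complex_manifold R n)
    (U W : set X) k (al : local_expr X k) : U `<=` W ->
  is_form W al -> is_form U al.
Proof.
move=> UW [f1 f2 f3 f4].
have s a := @chart_imageS _ _ _ a _ _ UW.
split.
- by move=> a v; apply: smooth_onS (f1 a v); exact: s.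
- by move=> a x /s; exact: f2.
- by move=> a x /s; exact: f3.
- move=> a b x abx; apply: f4; apply: chart_imageS abx => p [bp Up].
  by split=> //; exact: UW.
Qed.

Lemma is_formD (R : realType) (n : nat) (X : complex_manifold R n)
    (W : set X) k (al be : local_expr X k) : open W ->
  is_form W al -> is_form W be -> is_form W (addf al be).
Proof.
move=> oW [a1 a2 a3 a4] [b1 b2 b3 b4]; split.
- move=> a v.
  exact: (smooth_onD (@chart_image_open _ _ _ a _ oW) (a1 a v) (b1 a v)).
- by move=> a x ax v i c u w; rewrite /addf a2 // b2 //; ring.
- move=> a x ax v i j ij vij.
  by rewrite /addf (a3 _ _ _ _ i j) // (b3 _ _ _ _ i j) // addr0.
- by move=> a b x abx v; rewrite /addf (a4 _ b) // (b4 _ b).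
Qed.

Lemma is_formM (R : realType) (n : nat) (X : complex_manifold R n)
    (W : set X) k (f : X -> R) (al : local_expr X k) : open W ->
  smooth_function W f -> is_form W al -> is_form W (mulf f al).
Proof.
move=> oW /smooth_functionP fs [a1 a2 a3 a4]; split.
- move=> a v.
  exact: (smooth_onM (@chart_image_open _ _ _ a _ oW) (fs a) (a1 a v)).
- by move=> a x ax v i c u w; rewrite /mulf a2 //; ring.
- by move=> a x ax v i j ij vij; rewrite /mulf (a3 _ _ _ _ i j) // mulr0.
- move=> a b x abx v; rewrite /mulf (a4 _ b) //.
  by have /chart_imageP[_ _ [bx _]] := abx; rewrite transition_param.
Qed.

Lemma smooth_function_cst (R : realType) (n : nat) (X : complex_manifold R n)
    (W : set X) (c : R) : smooth_function W (fun=> c).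
Proof. by apply/smooth_functionP => a; exact: smooth_on_cst. Qed.

Lemma form1E (R : realType) (n : nat) (X : complex_manifold R n)
    (al : local_expr X 1) a x v : al a x v = al a x (fun=> v ord0).
Proof. by congr (al a x _); rewrite funeqE => i; rewrite (ord1 i). Qed.

Lemma form0E (R : realType) (n : nat) (X : complex_manifold R n)
    (al : local_expr X 0) a x v w : al a x v = al a x w.
Proof. by congr (al a x _); rewrite funeqE => -[]. Qed.

Lemma form1_linear (R : realType) (n : nat) (X : complex_manifold R n)
    (W : set X) (al : local_expr X 1) a x (c : R) u w :
  is_form W al -> chart_image a W x ->
  al a x (fun=> c *: u + w) = c * al a x (fun=> u) + al a x (fun=> w).
Proof.
move=> [_ f2 _ _] ax; have := f2 a x ax (fun=> 0) ord0 c u w.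
have E y : dfwith (fun _ : 'I_1 => 0) ord0 y = fun=> y.
  by rewrite funeqE => i; rewrite (ord1 i) dfwithin.
by rewrite !E.
Qed.

Lemma linear_rowE (R : realType) N (l : 'rV[R]_N -> R) v :
  (forall (c : R) u w, l (c *: u + w) = c * l u + l w) ->
  l v = \sum_i v 0 i * l (delta_mx 0 i).
Proof.
move=> lin.
have l0 : l 0 = 0.
  have := lin (-1) 0 0; rewrite scaler0 addr0 => h; lra.
have lD u w : l (u + w) = l u + l w.
  by have := lin 1 u w; rewrite scale1r mul1r.
rewrite {1}(row_sum_delta v) (big_morph l lD l0); apply: eq_bigr => i _.
by have := lin (v 0 i) (delta_mx 0 i) 0; rewrite l0 !addr0.
Qed.

Lemma dform0E (R : realType) (n : nat) (X : complex_manifold R n)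
    (al : local_expr X 0) a x v w :
  dform al a x v = 'D_(v ord0) (fun y => al a y w) x.
Proof.
rewrite /dform big_ord_recl big_ord0 addr0 expr0 mul1r.
have -> : (fun y => al a y (fun j => v (lift ord0 j))) = (fun y => al a y w).
  by rewrite funeqE => y; exact: form0E.
by [].
Qed.

Lemma dform_near (R : realType) (n : nat) (X : complex_manifold R n)
    k (al be : local_expr X k) a x v :
  (forall w, \forall y \near x, al a y w = be a y w) ->
  dform al a x v = dform be a x v.
Proof.
move=> ab; apply: eq_bigr => i _; congr (_ * _).
by apply: near_eq_derive; exact: ab.
Qed.

Lemma dform_eq (R : realType) (n : nat) (X : complex_manifold R n)
    (W : set X) k (al be : local_expr X k) : open W ->
  form_eq W al be -> form_eq W (dform al) (dform be).
Proof.
move=> oW ab a x ax v; apply: dform_near => w.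
have oa := @chart_image_open _ _ _ a _ oW.
by apply: filterS (open_nbhs_nbhs (conj oa ax)) => y /ab.
Qed.

Lemma dformM (R : realType) (n : nat) (X : complex_manifold R n)
    k (f : X -> R) (al : local_expr X k) a x v :
  (forall w, derivable (fun y => f (param a y)) x w) ->
  (forall w u, derivable (fun y => al a y u) x w) ->
  dform (mulf f al) a x v =
    wedge1 (dform (form0 f)) al a x v + mulf f (dform al) a x v.
Proof.
move=> df da; rewrite /wedge1 /mulf /(dform al) mulr_sumr -big_split /=.
apply: eq_bigr => i _.
rewrite (dform0E _ _ _ _ (fun=> 0)) /form0.
rewrite (@deriveM _ _ (fun y => f (param a y))
  (fun y => al a y (fun j => v (lift i j)))); [|exact: df|exact: da].
rewrite /GRing.scale /=.
ring.
Qed.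

Lemma dformD (R : realType) (n : nat) (X : complex_manifold R n)
    k (al be : local_expr X k) a x v :
  (forall w u, derivable (fun y => al a y u) x w) ->
  (forall w u, derivable (fun y => be a y u) x w) ->
  dform (addf al be) a x v = dform al a x v + dform be a x v.
Proof.
move=> da db; rewrite /dform -big_split; apply: eq_bigr => i _ /=.
rewrite -mulrDr; congr (_ * _).
rewrite (@deriveD _ _ _ (fun y => al a y (fun j => v (lift i j)))
  (fun y => be a y (fun j => v (lift i j)))).
- by [].
- exact: da.
- exact: db.
Qed.

Lemma dformZ (R : realType) (n : nat) (X : complex_manifold R n)
    k (c : R) (al : local_expr X k) a x v :
  (forall w u, derivable (fun y => al a y u) x w) ->
  dform (mulf (fun=> c) al) a x v = c * dform al a x v.
Proof.
move=> da; rewrite /dform mulr_sumr; apply: eq_bigr => i _.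
rewrite mulrCA; congr (_ * _).
exact: deriveZ (da _ _).
Qed.

Lemma is_form_derivable (R : realType) (n : nat) (X : complex_manifold R n)
    (W : set X) k (al : local_expr X k) a x w u :
  is_form W al -> chart_image a W x -> derivable (fun y => al a y u) x w.
Proof. by move=> [f1 _ _ _] ax; exact: smooth_on_derivable (f1 a u) ax. Qed.

Lemma wedge1_eq (R : realType) (n : nat) (X : complex_manifold R n)
    k (th th' : local_expr X 1) (al al' : local_expr X k) a x v :
  (forall u, th a x u = th' a x u) -> (forall u, al a x u = al' a x u) ->
  wedge1 th al a x v = wedge1 th' al' a x v.
Proof. by move=> tt aa; apply: eq_bigr => i _; rewrite tt aa. Qed.

Lemma wedge1Dl (R : realType) (n : nat) (X : complex_manifold R n)
    k (th th' : local_expr X 1) (al : local_expr X k) a x v :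
  wedge1 (addf th th') al a x v = wedge1 th al a x v + wedge1 th' al a x v.
Proof.
by rewrite /wedge1 -big_split; apply: eq_bigr => i _ /=; rewrite /addf; ring.
Qed.

Lemma wedge1Dr (R : realType) (n : nat) (X : complex_manifold R n)
    k (th : local_expr X 1) (al be : local_expr X k) a x v :
  wedge1 th (addf al be) a x v = wedge1 th al a x v + wedge1 th be a x v.
Proof.
by rewrite /wedge1 -big_split; apply: eq_bigr => i _ /=; rewrite /addf; ring.
Qed.

Lemma wedge1Ml (R : realType) (n : nat) (X : complex_manifold R n)
    k (f : X -> R) (th : local_expr X 1) (al : local_expr X k) a x v :
  wedge1 (mulf f th) al a x v = f (param a x) * wedge1 th al a x v.
Proof.
by rewrite /wedge1 mulr_sumr; apply: eq_bigr => i _; rewrite /mulf; ring.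
Qed.

Lemma wedge1Mr (R : realType) (n : nat) (X : complex_manifold R n)
    k (f : X -> R) (th : local_expr X 1) (al : local_expr X k) a x v :
  wedge1 th (mulf f al) a x v = f (param a x) * wedge1 th al a x v.
Proof.
by rewrite /wedge1 mulr_sumr; apply: eq_bigr => i _; rewrite /mulf; ring.
Qed.

Lemma closed_formD (R : realType) (n : nat) (X : complex_manifold R n)
    (W : set X) k (al be : local_expr X k) : open W ->
  closed_form W al -> closed_form W be -> closed_form W (addf al be).
Proof.
move=> oW [af ac] [bf bc]; split; first exact: is_formD.
move=> a x ax v; rewrite dformD.
- by rewrite ac // bc // /zerof addr0.
- by move=> w u; exact: is_form_derivable af ax.
- by move=> w u; exact: is_form_derivable bf ax.
Qed.

Lemma is_form_zerof (R : realType) (n : nat) (X : complex_manifold R n)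
    (W : set X) k : is_form W (@zerof R n X k).
Proof.
split.
- by move=> a v; exact: smooth_on_cst.
- by move=> a x _ v i c u w; rewrite /zerof mulr0 addr0.
- by [].
- by [].
Qed.

Lemma is_derive_sum_fun (R : realType) (V : normedModType R) N
    (h : 'I_N -> V -> R) (dh : 'I_N -> R) x v :
  (forall i, is_derive x v (h i) (dh i)) ->
  is_derive x v (fun y => \sum_(i < N) h i y) (\sum_(i < N) dh i).
Proof.
move=> H; have -> : (fun y => \sum_(i < N) h i y) = \sum_(i < N) h i.
  by rewrite funeqE => y; rewrite fct_sumE.
exact: is_derive_sum.
Qed.

(** * The Lee form as a trace of the differential of the fundamental form *)

Lemma J_linear (R : realType) (n : nat) (c : R) (u v : Cn R n) :
  J (c *: u + v) = c *: J u + J v.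
Proof.
by rewrite /J !linearP /= scale_row_mx add_row_mx.
Qed.

Lemma J_J (R : realType) (n : nat) (u : Cn R n) : J (J u) = - u.
Proof.
rewrite /J row_mxKr row_mxKl -[in RHS](hsubmxK u) opp_row_mx.
by [].
Qed.

(** The form g (J u, v) is antisymmetric because J is a g-isometry of
    square -1, and it is nondegenerate because its value on (u, J u) is
    g (J u, J u). *)
Lemma fundamental_form_bilinear (R : realType) (n : nat)
    (X : complex_manifold R n) (om : local_expr X 2) a x :
  fundamental_form om -> chart_image a setT x ->
  exists B : Cn R n -> Cn R n -> R,
    [/\ forall v, om a x v = B (v ord0) (v ord_max),
        forall (c : R) u v w, B (c *: u + v) w = c * B u w + B v w,
        forall u v, B u v = - B v u
      & forall u, u != 0 -> B u (J u) != 0].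
Proof.
move=> [_ [g [_ [gx _]] omg]] ax.
have [glin gsym gJ gpos] := gx a x ax.
exists (fun u v => g a x (J u) v); split.
- exact: omg.
- by move=> c u v w; rewrite J_linear glin.
- move=> u v.
  rewrite gsym -gJ J_J gsym.
  have g0 : g a x 0 (J v) = 0.
    have := glin (-1) 0 0 (J v); rewrite scaler0 addr0 => h; lra.
  have := glin (-1) u 0 (J v); rewrite scaleN1r addr0 g0 addr0 => ->.
  by rewrite mulN1r gsym.
- by move=> u u0; rewrite gJ gt_eqF // gpos.
Qed.

Lemma wedge1_2E (R : realType) (n : nat) (X : complex_manifold R n)
    (th : local_expr X 1) (om : local_expr X 2) a x B v :
  (forall w, om a x w = B (w ord0) (w ord_max)) ->
  wedge1 th om a x v =
    th a x (fun=> v ord0) * B (v (lift ord0 ord0)) (v ord_max) -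
    th a x (fun=> v (lift ord0 ord0)) * B (v ord0) (v ord_max) +
    th a x (fun=> v ord_max) * B (v ord0) (v (lift ord0 ord0)).
Proof.
move=> omB; rewrite /wedge1 !big_ord_recl big_ord0 !omB.
have e1 : lift (ord0 : 'I_3) (ord_max : 'I_2) = ord_max by exact/val_inj.
have e2 : lift (lift ord0 ord0 : 'I_3) (ord0 : 'I_2) = ord0 by exact/val_inj.
have e3 : lift (lift ord0 ord0 : 'I_3) (ord_max : 'I_2) = ord_max.
  exact/val_inj.
have e4 : lift ord0 (lift ord0 (ord0 : 'I_1)) = ord_max :> 'I_3.
  exact/val_inj.
have e5 : lift (ord_max : 'I_3) (ord0 : 'I_2) = ord0 by exact/val_inj.
have e6 : lift (ord_max : 'I_3) (ord_max : 'I_2) = lift ord0 ord0.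
  exact/val_inj.
have s0 : (-1 : R) ^+ (ord0 : 'I_3) = 1 by exact: expr0.
have s1 : (-1 : R) ^+ (lift ord0 ord0 : 'I_3) = -1 by exact: expr1.
have s2 : (-1 : R) ^+ (ord_max : 'I_3) = 1.
  by rewrite -[LHS]/((-1) ^+ 2) sqrrN expr1n.
rewrite e4 e1 e2 e3 e5 e6 s0 s1 s2.
by rewrite !mul1r mulN1r mulNr addr0 addrA.
Qed.

(** A real vector space of dimension at most 2 has no nonzero alternating
    3-forms. *)
Lemma wedge1_dim_le1 (R : realType) (n : nat) (X : complex_manifold R n)
    (th : local_expr X 1) (om : local_expr X 2) a x v : (n <= 1)%N ->
  is_form setT th -> fundamental_form om -> chart_image a setT x ->
  wedge1 th om a x v = 0.
Proof.
move=> n1 thf omf ax.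
have [B [omB Blin Banti _]] := fundamental_form_bilinear omf ax.
rewrite (wedge1_2E _ _ omB).
pose h u := th a x (fun=> u).
have hE u : h u = \sum_i u 0 i * h (delta_mx 0 i).
  by apply: linear_rowE => c w w'; exact: form1_linear thf ax.
have Bl u w : B u w = \sum_i u 0 i * B (delta_mx 0 i) w.
  by apply: (@linear_rowE _ _ (B^~ w)) => c w1 w2; exact: Blin.
have BE u w : B u w =
    \sum_i \sum_j u 0 i * w 0 j * B (delta_mx 0 i) (delta_mx 0 j).
  rewrite Bl; apply: eq_bigr => i _; rewrite Banti Bl -sumrN mulr_sumr.
  by apply: eq_bigr => j _; rewrite Banti !mulrN opprK mulrA.
rewrite -!/(h _) !hE !BE.
move: h hE Bl BE omB Blin Banti v => h _ _ _ _ _ Banti v.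
move: (v ord0) (v _) (v ord_max) => v0 v1 v2.
have B0 u : B u u = 0 by have := Banti u u; lra.
case: n n1 X th om a x v thf omf ax h B Banti B0 v0 v1 v2
  => [|[|//]] _ X th om a x v _ _ _ h B Banti B0 v0 v1 v2.
  by rewrite !big_ord0 !mul0r; ring.
rewrite !big_ord_recl !big_ord0 !B0.
rewrite !(Banti (delta_mx 0 (lift ord0 ord0)) (delta_mx 0 ord0)).
ring.
Qed.

(** Tracing the two last arguments of eta /\ om against the inverse of om
    gives N eta from the term where eta eats the first vector, and - eta from
    each of the two others. *)
Lemma symplectic_trace_identity (R : realType) N (W : 'M[R]_N) (h : 'I_N -> R)
    (v : 'rV[R]_N) : W \in unitmx -> (forall i j, W i j = - W j i) ->
  \sum_i \sum_j invmx W j i *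
    ((\sum_k v 0 k * h k) * W i j - h i * (v *m W) 0 j + h j * (v *m W) 0 i) =
  (N%:R - 2) * \sum_k v 0 k * h k.
Proof.
move=> Wu Wanti; set hv := \sum_k v 0 k * h k.
have Wv i : \sum_j (v *m W) 0 j * invmx W j i = v 0 i.
  by have /matrixP/(_ 0 i) := mulmxK Wu v; rewrite mxE.
have vW j : \sum_i invmx W j i * (v *m W) 0 i = - v 0 j.
  have E i : (v *m W) 0 i = - (W *m v^T) i 0.
    rewrite !mxE -sumrN; apply: eq_bigr => k _.
    by rewrite !mxE Wanti mulrN mulrC.
  under eq_bigr do rewrite E mulrN.
  rewrite sumrN; congr (- _).
  by have /matrixP/(_ j 0) := mulKmx Wu v^T; rewrite !mxE.
have tr : \sum_i \sum_j invmx W j i * W i j = N%:R.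
  have := mxtrace1 R N; rewrite -(mulmxV Wu) /mxtrace => <-.
  by apply: eq_bigr => i _; rewrite mxE; apply: eq_bigr => j _; rewrite mulrC.
transitivity (hv * (\sum_i \sum_j invmx W j i * W i j)
  - \sum_i h i * (\sum_j (v *m W) 0 j * invmx W j i)
  + \sum_j h j * (\sum_i invmx W j i * (v *m W) 0 i)).
  have -> : \sum_j h j * (\sum_i invmx W j i * (v *m W) 0 i) =
     \sum_i \sum_j h j * (invmx W j i * (v *m W) 0 i).
    by rewrite exchange_big; apply: eq_bigr => j _; rewrite mulr_sumr.
  rewrite mulr_sumr -sumrB -big_split; apply: eq_bigr => i _.
  rewrite !mulr_sumr -sumrB -big_split; apply: eq_bigr => j _ /=.
  ring.
rewrite tr; under eq_bigr do rewrite Wv.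
under [X in _ + X]eq_bigr do rewrite vW mulrN.
rewrite sumrN.
have -> : \sum_i h i * v 0 i = hv by apply: eq_bigr => i _; rewrite mulrC.
ring.
Qed.

Definition vec (R : realType) (n k : nat) (s : seq (Cn R n)) : 'I_k -> Cn R n :=
  fun i => nth 0 s i.

Definition gram (R : realType) (n : nat) (X : complex_manifold R n)
    (om : local_expr X 2) a x : 'M[R]_(n + n) :=
  \matrix_(i, j) om a x (vec [:: delta_mx 0 i; delta_mx 0 j]).

(** The trace of [d om] over its last two arguments with respect to [om]: up
    to the factor 2 n - 2, the Lee form. *)
Definition symplectic_trace (R : realType) (n : nat) (X : complex_manifold R n)
    (om : local_expr X 2) : local_expr X 1 :=
  fun a x v => \sum_i \sum_j invmx (gram om a x) j i *
    dform om a x (vec [:: v ord0; delta_mx 0 i; delta_mx 0 j]).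

Lemma gram_unit (R : realType) (n : nat) (X : complex_manifold R n)
    (om : local_expr X 2) a x :
  fundamental_form om -> chart_image a setT x -> gram om a x \in unitmx.
Proof.
move=> omf ax.
have [B [omB Blin Banti Bpos]] := fundamental_form_bilinear omf ax.
rewrite unitmxE unitfE; apply/det0P => -[v v0 vW].
have Bv j : B v (delta_mx 0 j) = 0.
  have /matrixP/(_ 0 j) := vW; rewrite !mxE => <-.
  rewrite (@linear_rowE _ _ (B^~ (delta_mx 0 j))).
    by apply: eq_bigr => i _; rewrite mxE omB.
  by move=> c w1 w2; exact: Blin.
have /negP := Bpos v v0; apply.
rewrite Banti (@linear_rowE _ _ (B^~ v)).
  by rewrite big1 ?oppr0 // => i _; rewrite Banti Bv oppr0 mulr0.
by move=> c w1 w2; exact: Blin.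
Qed.

(** So in complex dimension at least 2 the Lee form is determined by the
    fundamental form, through a formula rational in the coefficients of [om]
    and of its first derivatives. *)
Lemma symplectic_traceE (R : realType) (n : nat) (X : complex_manifold R n)
    (om : local_expr X 2) (eta : local_expr X 1) a x v :
  fundamental_form om -> lee_form om eta -> chart_image a setT x ->
  symplectic_trace om a x v = ((n + n)%:R - 2) * eta a x v.
Proof.
move=> omf [[etaf _] etaE] ax.
have [B [omB Blin Banti Bpos]] := fundamental_form_bilinear omf ax.
pose h u := eta a x (fun=> u).
have hE u : h u = \sum_i u 0 i * h (delta_mx 0 i).
  by apply: linear_rowE => c w w'; exact: form1_linear etaf ax.
have gE i j : gram om a x i j = B (delta_mx 0 i) (delta_mx 0 j).
  by rewrite mxE omB.
have Bg u j : B u (delta_mx 0 j) = (u *m gram om a x) 0 j.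
  rewrite mxE (@linear_rowE _ _ (B^~ (delta_mx 0 j))).
    by apply: eq_bigr => i _; rewrite gE.
  by move=> c w1 w2; exact: Blin.
rewrite [in RHS]form1E -/(h _) hE.
rewrite -(@symplectic_trace_identity _ _ (gram om a x)).
- apply: eq_bigr => i _; apply: eq_bigr => j _; congr (_ * _).
  by rewrite etaE // (wedge1_2E _ _ omB) /= -!Bg gE -hE.
- exact: gram_unit.
- by move=> i j; rewrite !gE Banti.
Qed.

(** * Families of forms and their derivative at zero *)

Lemma family_domain_open (R : realType) (n : nat) (X : complex_manifold R n)
    (a : chart X) (e : R) :
  open [set z : (R * Cn R n)%type | `|z.1| < e /\ chart_image a setT z.2].
Proof.
have -> : [set z : (R * Cn R n)%type | `|z.1| < e /\ chart_image a setT z.2] =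
    (fst @^-1` [set s : R | `|s| < e]) `&` (snd @^-1` chart_image a setT) by [].
apply: openI; apply: open_comp.
- by move=> z _; exact: cvg_fst.
- apply: (@open_comp _ _ (fun s : R => `|s|) [set r | r < e]).
    by move=> s _; exact: norm_continuous.
  exact: open_lt.
- by move=> z _; exact: cvg_snd.
- by apply: chart_image_open; exact: openT.
Qed.

Lemma smooth_family_dform (R : realType) (n : nat) (X : complex_manifold R n)
    (e : R) k (al : R -> local_expr X k) a v : smooth_family e al ->
  smooth_on
    [set z : (R * Cn R n)%type | `|z.1| < e /\ chart_image a setT z.2]
    (fun z => dform (al z.1) a z.2 v).
Proof.
move=> [_ als].
have oA := @family_domain_open _ _ X a e.
suff H (i : 'I_k.+1) : smooth_on
    [set z : (R * Cn R n)%type | `|z.1| < e /\ chart_image a setT z.2]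
    (fun z => (-1) ^+ i *
      'D_(v i) (fun y => al z.1 a y (fun j => v (lift i j))) z.2).
  exact: smooth_on_sum oA H.
apply: (smooth_onM oA); first exact: smooth_on_cst.
apply: (@smooth_on_ext _ _ _ _ ('D_((0 : R), v i)
  (fun z : R * Cn R n => al z.1 a z.2 (fun j => v (lift i j)))) _ oA).
  move=> [s x] _ /=.
  exact/esym/(@derive_pair2 _ _ _ (fun z : R * Cn R n => al z.1 a z.2 _)).
exact: smooth_on_derive (als a _).
Qed.

(** The Lee forms are only given one parameter at a time.  They depend smoothly
    on it because the trace formula expresses them by the forms [om s]. *)
Lemma lee_form_family (R : realType) (n : nat) (X : complex_manifold R n)
    (e : R) (om : R -> local_expr X 2) (eta : R -> local_expr X 1) :
  (1 < n)%N -> smooth_family e om ->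
  (forall s, `|s| < e -> fundamental_form (om s)) ->
  (forall s, `|s| < e -> lee_form (om s) (eta s)) ->
  smooth_family e eta.
Proof.
move=> n1 oms omf lee; split; first by move=> s /lee[[]].
move=> a v.
have oA := @family_domain_open _ _ X a e.
(* Complex dimension 1 is excluded here: the trace vanishes there. *)
have c0 : (n + n)%:R - 2 != 0 :> R.
  by rewrite gt_eqF // subr_gt0 ltr_nat addnn (ltn_double 1).
suff H : smooth_on
    [set z : (R * Cn R n)%type | `|z.1| < e /\ chart_image a setT z.2]
    (fun z => ((n + n)%:R - 2)^-1 * symplectic_trace (om z.1) a z.2 v).
  apply: (smooth_on_ext oA _ H) => -[s x] /= [se ax].
  by rewrite (symplectic_traceE _ (omf s se) (lee s se) ax) mulKf.
apply: (smooth_onM oA); first exact: smooth_on_cst.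
suff H (i j : 'I_(n + n)) : smooth_on
    [set z : (R * Cn R n)%type | `|z.1| < e /\ chart_image a setT z.2]
    (fun z => invmx (gram (om z.1) a z.2) j i *
      dform (om z.1) a z.2 (vec [:: v ord0; delta_mx 0 i; delta_mx 0 j])).
  have H' i := smooth_on_sum oA (H i).
  exact: smooth_on_sum oA H'.
apply: (smooth_onM oA); last exact: smooth_family_dform.
apply: (@smooth_on_invmx _ _ _ _
  (fun z : R * Cn R n => gram (om z.1) a z.2) _ _ oA).
  by move=> [s x] /= [se ax]; exact: gram_unit (omf s se) ax.
move=> k l; apply: (smooth_on_ext oA _ (oms.2 a _)) => z _.
by rewrite mxE.
Qed.

Lemma smooth_familyD (R : realType) (n : nat) (X : complex_manifold R n)
    (e : R) k (al be : R -> local_expr X k) :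
  smooth_family e al -> smooth_family e be ->
  smooth_family e (fun s => addf (al s) (be s)).
Proof.
move=> [a1 a2] [b1 b2]; split.
  by move=> s se; apply: is_formD; [exact: openT|exact: a1|exact: b1].
move=> a v.
exact: (smooth_onD (@family_domain_open _ _ X a e) (a2 a v) (b2 a v)).
Qed.

Lemma smooth_familyS (R : realType) (n : nat) (X : complex_manifold R n)
    (d e : R) k (al : R -> local_expr X k) : d <= e ->
  smooth_family e al -> smooth_family d al.
Proof.
move=> de [a1 a2]; split.
  by move=> s sd; apply: a1; exact: lt_le_trans de.
move=> a v; apply: smooth_onS (a2 a v) => z [zd az]; split=> //.
exact: lt_le_trans de.
Qed.

(** The derivative in the parameter is a directional derivative on the product
    of the line and the chart, where the family is smooth. *)
Lemma dot0E (R : realType) (n : nat) (X : complex_manifold R n)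
    (e : R) k (al : R -> local_expr X k) a x v :
  0 < e -> smooth_family e al -> chart_image a setT x ->
  dot0 al a x v =
    'D_((1 : R), 0) (fun z : R * Cn R n => al z.1 a z.2 v) (0, x) /\
  is_derive (0 : R) (1 : R) (fun s => al s a x v) (dot0 al a x v).
Proof.
move=> e0 [_ als] ax.
have A0 : [set z : (R * Cn R n)%type | `|z.1| < e /\ chart_image a setT z.2]
  (0, x) by rewrite /= normr0.
have H := is_derive_pair1 (smooth_on_derivable (als a v) A0).
have [h1 h2] := H.
have E : dot0 al a x v =
    'D_((1 : R), 0) (fun z : R * Cn R n => al z.1 a z.2 v) (0, x).
  by rewrite /dot0 derive1E -h2.
by split; [exact: E|rewrite E; exact: H].
Qed.

Lemma dot0_form (R : realType) (n : nat) (X : complex_manifold R n)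
    (e : R) k (al : R -> local_expr X k) :
  0 < e -> smooth_family e al -> is_form setT (dot0 al).
Proof.
move=> e0 alf; have [al1 al2] := alf.
have N : \forall s \near (0 : R), `|s| < e by exact: nbhs0_lt.
have D a x v ax := (@dot0E _ _ _ _ _ al a x v e0 alf ax).2.
split.
- move=> a v.
  have oA := @chart_image_open _ _ X a setT openT.
  apply: (@smooth_on_ext _ _ _ _ (fun x =>
    'D_((1 : R), 0) (fun z : R * Cn R n => al z.1 a z.2 v) (0, x)) _ oA).
    by move=> x ax; exact/esym/(@dot0E _ _ _ _ _ al a x v e0 alf ax).1.
  have S := @smooth_on_slice _ _ _ _ _ 0
    (@smooth_on_derive _ _ _ _ _ ((1 : R), 0) (al2 a v)).
  apply: smooth_onS S.
  by move=> x ax /=; rewrite normr0.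
- move=> a x ax v i c u w.
  have H : is_derive (0 : R) (1 : R)
    (fun s => c * al s a x (dfwith v i u) + al s a x (dfwith v i w))
    (c * dot0 al a x (dfwith v i u) + dot0 al a x (dfwith v i w)).
    apply: is_deriveD; last exact: D.
    by apply: is_deriveZ; exact: D.
  have [_ <-] := H; rewrite {1}/dot0 derive1E.
  apply: near_eq_derive; apply: filterS N => s se.
  by have [_ -> //] := al1 s se.
- move=> a x ax v i j ij vij.
  rewrite /dot0 derive1E.
  apply: (etrans _ (@derive_cst R R R 0 0 1)).
  apply: near_eq_derive; apply: filterS N => s se.
  by have [_ _ f3 _] := al1 s se; exact: f3 ij vij.
- move=> a b x abx v.
  rewrite /dot0 !derive1E; apply: near_eq_derive; apply: filterS N => s se.
  by have [_ _ _ f4] := al1 s se; exact: f4.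
Qed.

(** The exterior derivative commutes with the derivative in the parameter:
    this is the symmetry of mixed derivatives on the product. *)
Lemma dform_dot0 (R : realType) (n : nat) (X : complex_manifold R n)
    (e : R) k (al : R -> local_expr X k) a x v :
  0 < e -> smooth_family e al -> chart_image a setT x ->
  is_derive (0 : R) (1 : R) (fun s => dform (al s) a x v)
    (dform (dot0 al) a x v).
Proof.
move=> e0 alf ax.
have oA := @family_domain_open _ _ X a e.
have A0 : [set z : (R * Cn R n)%type | `|z.1| < e /\ chart_image a setT z.2]
  (0, x) by rewrite /= normr0.
suff H (i : 'I_k.+1) : is_derive (0 : R) (1 : R) (fun s => (-1) ^+ i *
    'D_(v i) (fun y => al s a y (fun j => v (lift i j))) x)
    ((-1) ^+ i *
    'D_(v i) (fun y => dot0 al a y (fun j => v (lift i j))) x).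
  exact: is_derive_sum_fun H.
apply: is_deriveZ.
pose F (z : R * Cn R n) := al z.1 a z.2 (fun j => v (lift i j)).
have Fs : smooth_on
  [set z : (R * Cn R n)%type | `|z.1| < e /\ chart_image a setT z.2] F.
  exact: alf.2.
have -> : (fun s => 'D_(v i) (fun y => al s a y (fun j => v (lift i j))) x) =
    (fun s => 'D_((0 : R), v i) F (s, x)).
  by rewrite funeqE => s; exact: (@derive_pair2 _ _ _ F).
have -> : 'D_(v i) (fun y => dot0 al a y (fun j => v (lift i j))) x =
    'D_((1 : R), 0) ('D_((0 : R), v i) F) (0, x).
  rewrite (schwarz _ _ oA Fs A0) -derive_pair2.
  apply: near_eq_derive.
  have := open_nbhs_nbhs (conj (@chart_image_open _ _ X a setT openT) ax).
  by apply: filterS => y ay; exact: (@dot0E _ _ _ _ _ al a y _ e0 alf ay).1.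
apply: is_derive_pair1.
exact: smooth_on_derivable (smooth_on_derive _ Fs) A0.
Qed.

Lemma wedge1_dot0 (R : realType) (n : nat) (X : complex_manifold R n)
    (e : R) k (th : R -> local_expr X 1) (al : R -> local_expr X k) a x v :
  0 < e -> smooth_family e th -> smooth_family e al -> chart_image a setT x ->
  is_derive (0 : R) (1 : R) (fun s => wedge1 (th s) (al s) a x v)
    (wedge1 (dot0 th) (al 0) a x v + wedge1 (th 0) (dot0 al) a x v).
Proof.
move=> e0 thf alf ax.
rewrite /wedge1 -big_split /=.
suff H (i : 'I_k.+1) : is_derive (0 : R) (1 : R)
    (fun s => (-1) ^+ i * th s a x (fun=> v i) *
      al s a x (fun j => v (lift i j)))
    ((-1) ^+ i * dot0 th a x (fun=> v i) * al 0 a x (fun j => v (lift i j)) +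
     (-1) ^+ i * th 0 a x (fun=> v i) * dot0 al a x (fun j => v (lift i j))).
  exact: is_derive_sum_fun H.
have [_ Dt] := @dot0E _ _ _ _ _ th a x (fun=> v i) e0 thf ax.
have [_ Da] := @dot0E _ _ _ _ _ al a x (fun j => v (lift i j)) e0 alf ax.
apply: is_derive_eq (is_deriveM (is_deriveZ ((-1) ^+ i) Dt) Da) _.
by rewrite /GRing.scale /= addrC [X in X + _]mulrC.
Qed.

(** * Potentials of the derivative of a family with exact differences *)

Lemma dot0_closed (R : realType) (n : nat) (X : complex_manifold R n)
    (e : R) k (al : R -> local_expr X k) :
  0 < e -> smooth_family e al ->
  (forall s, `|s| < e -> closed_form setT (al s)) ->
  closed_form setT (dot0 al).
Proof.
move=> e0 alf alc; split; first exact: dot0_form e0 alf.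
move=> a x ax v; have [_ <-] := dform_dot0 v e0 alf ax.
apply: (etrans _ (@derive_cst R R R 0 0 1)).
have N : \forall s \near (0 : R), `|s| < e by exact: nbhs0_lt.
apply: near_eq_derive; apply: filterS N => s se.
by have [_ ->] := alc s se.
Qed.

(** On a member of the good cover the closed form [dot0 beta] has a primitive
    [G], and the increments of [u s], divided by [s], tend to those of [G]. *)
Lemma local_potential (R : realType) (n : nat) (X : complex_manifold R n)
    (e : R) (beta : R -> local_expr X 1) (I : Type) (U : I -> set X)
    (u : R -> X -> R) (a : chart X) (x0 : Cn R n) :
  0 < e -> smooth_family e beta ->
  (forall s, `|s| < e -> closed_form setT (beta s)) ->
  (forall i, open (U i)) -> (forall p, exists i, U i p) ->
  (forall i, acyclic (U i)) ->
  (forall s a x v, `|s| < e -> chart_image a setT x ->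
    is_derive x v (fun y => u s (param a y))
      (beta s a x (fun=> v) - beta 0 a x (fun=> v))) ->
  chart_image a setT x0 ->
  exists (G : Cn R n -> R) (B : set (Cn R n)),
    [/\ open B, B x0, smooth_on B G,
      forall x v, B x -> 'D_v G x = dot0 beta a x (fun=> v)
    & forall x, B x -> s^-1 * (u s (param a x) - u s (param a x0))
        @[s --> (0 : R)^'] --> G x - G x0].
Proof.
move=> e0 bf bc oU cU aU du ax0.
have [thf thc] := dot0_closed e0 bf bc.
have [i Ui] := cU (param a x0).
have [|g gf gth] := aU i 0%N (dot0 beta).
  split; first exact: is_formS thf.
  by move=> a' x ax'; apply: thc; exact: chart_imageS ax'.
have oV := @chart_image_open _ _ _ a _ (oU i).
have Vx0 : chart_image a (U i) x0.
  by have /chart_imageP[? ? _] := ax0; apply/chart_imageP.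
have /nbhs_ballP[r /= r0 rV] := open_nbhs_nbhs (conj oV Vx0).
pose G x := g a x (fun=> 0).
have Gs : smooth_on (chart_image a (U i)) G by have [f1 _ _ _] := gf; exact: f1.
have VT x : chart_image a (U i) x -> chart_image a setT x.
  by apply: chart_imageS.
have GD x v : chart_image a (U i) x -> 'D_v G x = dot0 beta a x (fun=> v).
  by move=> Vx; rewrite -gth // (dform0E _ _ _ _ (fun=> 0)).
exists G, (ball x0 r); split.
- exact: ball_open.
- exact: ballxx.
- exact: smooth_onS rV Gs.
- by move=> x v /rV; exact: GD.
move=> x Bx.
have Bt (t : R) : `|t| <= 1 -> chart_image a (U i) (t *: (x - x0) + x0).
  move=> t1; apply: rV; move: Bx; rewrite -!ball_normE /= => Bx.
  rewrite distrC addrK normrZ distrC.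
  by apply: le_lt_trans Bx; rewrite ler_piMl.
have oA := @family_domain_open _ _ X a e.
have L := @limit_of_primitives R (Cn R n)
  [set z : (R * Cn R n)%type | `|z.1| < e /\ chart_image a setT z.2]
  (fun z => beta z.1 a z.2 (fun=> x - x0)) G (fun s y => u s (param a y)) e
  x0 (x - x0) oA (bf.2 a _) e0.
rewrite subrK in L; apply: L.
- by move=> t /Bt Vt /=; rewrite normr0; split=> //; exact: VT.
- move=> t /Bt Vt.
  rewrite -(@dot0E _ _ _ _ _ beta _ _ _ e0 bf (VT _ Vt)).1 -GD //.
  by apply: derivableP; exact: smooth_on_derivable Gs Vt.
- by move=> s t se /Bt Vt; apply: du => //; exact: VT.
Qed.

(** The functions [s^-1 * u s] need not converge, being determined up to
    constants that may depend on [s] and on the connected component.  The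
    existence of the limit of their difference at two points is an equivalence
    relation; subtracting the value at a representative of each class makes
    them converge. *)
Lemma glue_limits (R : realType) (T : choiceType) (u : R -> T -> R) :
  exists w : T -> R, forall p q l,
    s^-1 * (u s p - u s q) @[s --> (0 : R)^'] --> l -> w p - w q = l.
Proof.
(* D p q is the difference of the quotients at p and q; E p q says that it
   converges. *)
pose D p q s := s^-1 * (u s p - u s q).
pose E p q := cvg (D p q s @[s --> (0 : R)^']).
have DB p q r : D p q = (fun s => D p r s - D q r s).
  by rewrite funeqE => s; rewrite /D; ring.
have EB p q r : E p r -> E q r -> E p q.
  by move=> pr qr; rewrite /E (DB p q r); exact: is_cvgB.
have E0 p : E p p.
  rewrite /E; have -> : D p p = (fun=> 0).
    by rewrite funeqE => s; rewrite /D subrr mulr0.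
  exact: is_cvg_cst.
have EC p q : E p q -> E q p by move=> pq; apply: EB pq; exact: E0.
pose rep p := xget p [set q | E p q].
have Erep p : E p (rep p) by exact: (@xgetI _ p [set q | E p q] p (E0 p)).
have repE p q : E p q -> rep p = rep q.
  move=> pq.
  have S : [set r | E p r] = [set r | E q r].
    apply/seteqP; split=> r /= h; first by apply: EB (EC _ _ h); exact: EC.
    by apply: EB (EC _ _ h).
  rewrite /rep S /xget; case: pselect => // -[].
  by exists q; apply/asboolP; exact: E0.
exists (fun p => lim (D p (rep p) s @[s --> (0 : R)^'])) => p q l Dl.
have pq : E p q by apply/cvg_ex; exists l.
have := cvgB (Erep p) (Erep q).
rewrite -(repE _ _ pq) => Dr.
apply: (cvg_unique _ _ Dl); first exact: norm_hausdorff.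
rewrite -/(D p q) (DB p q (rep p)); exact: Dr.
Qed.

(** The derivative of a curve in a coset of the exact forms is a limit of exact
    forms, and exactness passes to limits.  The primitives [u s], chosen
    separately for each [s], enter only through their increments, whose limits
    are increments of a primitive of the derivative. *)
Lemma family_potential (R : realType) (n : nat) (X : complex_manifold R n)
    (e : R) (beta : R -> local_expr X 1) (I : Type) (U : I -> set X)
    (u : R -> X -> R) :
  0 < e -> smooth_family e beta ->
  (forall s, `|s| < e -> closed_form setT (beta s)) ->
  (forall i, open (U i)) -> (forall p, exists i, U i p) ->
  (forall i, acyclic (U i)) ->
  (forall s a x v, `|s| < e -> chart_image a setT x ->
    is_derive x v (fun y => u s (param a y))
      (beta s a x (fun=> v) - beta 0 a x (fun=> v))) ->
  exists2 w : X -> R, smooth_function setT w &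
    form_eq setT (dform (form0 w)) (dot0 beta).
Proof.
move=> e0 bf bc oU cU aU du.
have [w wE] := glue_limits u.
have loc a x0 : chart_image a setT x0 -> exists (B : set (Cn R n)),
    [/\ open B, B x0, smooth_on B (fun x => w (param a x)) &
      forall v, 'D_v (fun x => w (param a x)) x0 = dot0 beta a x0 (fun=> v)].
  move=> ax0.
  have [G [B [oB Bx0 Gs GD GL]]] :=
    local_potential e0 bf bc oU cU aU du ax0.
  pose G' x := G x + (w (param a x0) - G x0).
  have G's : smooth_on B G'.
    apply: (smooth_onD oB Gs); exact: smooth_on_cst.
  have wG x : B x -> G' x = w (param a x).
    by move=> /GL /wE h; rewrite /G' addrCA -h addrC subrK.
  exists B; split; [exact: oB|exact: Bx0|exact: smooth_on_ext oB wG G's|].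
  move=> v; rewrite -GD //.
  rewrite -(@near_eq_derive _ _ _ G'); last first.
    by apply: filterS (open_nbhs_nbhs (conj oB Bx0)) => x /wG.
  rewrite deriveD; first by rewrite derive_cst addr0.
    exact: smooth_on_derivable Gs Bx0.
  exact: derivable_cst.
exists w.
  apply/smooth_functionP => a vs x ax.
  by have [B [_ Bx Bs _]] := loc a x ax; exact: Bs.
move=> a x ax v; rewrite (dform0E _ _ _ _ (fun=> 0)).
have [B [_ _ _ ->]] := loc a x ax.
by rewrite [RHS]form1E.
Qed.

(** * Lee forms and their flat line bundles *)

Lemma locally_constant_smooth (R : realType) (n : nat)
    (X : complex_manifold R n) (W : set X) (f : X -> R) :
  locally_constant_on W f -> smooth_function W f.
Proof.
move=> fc; apply/smooth_functionP => a vs x ax.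
have /chart_imageP[_ _ Wx] := ax.
have N := chart_image_near (chart_imageS (@subsetT _ W) ax) (fc _ Wx).
apply: (@smooth_on_near _ _ _ [set x] (fun=> f (param a x))); last by [].
  move=> _ ->; apply: filterS N => y /chart_imageP[_ _ /= ->]; by [].
exact: smooth_on_cst.
Qed.

Lemma cocycle_diag (R : realType) (n : nat) (X : complex_manifold R n)
    (L : flat_line_bundle X) (i : idx L) p : cov i p -> cocycle i i p = 1.
Proof.
move=> ip; apply: (mulfI (cocycle_neq0 ip ip)).
by rewrite mulr1; exact: cocycleM.
Qed.

(** Over the open set of index [c] the bundle [N] has the nowhere zero flat
    section t_b = g_bc.  Its image in [L] is the family h_ic, which is
    therefore killed by d + th. *)
Lemma deformed_bundle_log_derivative (R : realType) (n : nat)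
    (X : complex_manifold R n) (th : local_expr X 1)
    (L N : flat_line_bundle X) :
  deformed_bundle L th N ->
  exists h : idx L -> idx N -> X -> R,
    [/\ forall i c p, cov i p -> cov c p -> h i c p != 0,
        forall i j c b p, cov i p -> cov j p -> cov c p -> cov b p ->
          h i c p * cocycle c b p = cocycle i j p * h j b p
      & forall i c a x v, chart_image a (cov i `&` cov c) x ->
          is_derive x v (fun y => h i c (param a y))
            (- (th a x (fun=> v) * h i c (param a x)))].
Proof.
move=> [h [hs h0 hc hflat]]; exists h; split=> //.
move=> i c a x v ax.
have oc := @cov_open _ _ _ N c.
have secs : is_section (cov c) (fun j => h j c).
  split=> [j|j k a' y ay u]; first exact: hs.
  have /chart_imageP[_ _ [[jy ky] cy]] := ay.
  by have := hc j k c c _ jy ky cy cy; rewrite cocycle_diag ?mulr1.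
have tlc b : locally_constant_on (cov b `&` cov c) (@cocycle _ _ _ N b c).
  exact: cocycle_constant.
have sect : is_section (cov c) (fun b => @cocycle _ _ _ N b c).
  split=> [b|b d a' y ay u]; first exact: locally_constant_smooth (tlc b).
  have /chart_imageP[_ _ [[by' dy] cy]] := ay.
  by rewrite /section0 /form0 /mulf (cocycleM by' dy cy).
have rel j b p : cov j p -> cov b p -> cov c p ->
    h j c p = h j b p * cocycle b c p.
  by move=> jp bp cp; rewrite (hc j j b c) // cocycle_diag // mul1r.
have [/(_ (conj sect tlc)) fl _] := hflat _ _ _ oc secs sect rel.
have := fl i a x ax (fun=> v).
rewrite /d_bundle_plus /addf /d_bundle /section0 (dform0E _ _ _ _ (fun=> 0)).
rewrite /wedge1 big_ord_recl big_ord0 addr0 expr0 mul1r /zerof /form0 => E.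
have /smooth_functionP/(_ a) hsm := hs i c.
split; first exact: smooth_on_derivable hsm ax.
by apply/eqP; rewrite -addr_eq0 E.
Qed.

Lemma is_derive_ext (R : realType) (V W : normedModType R) (f g : V -> W)
    (x v : V) (df dg : W) :
  is_derive x v f df -> f =1 g -> df = dg -> is_derive x v g dg.
Proof. by move=> fd /funext <- <-. Qed.

(** The logarithm of the absolute value of [g], up to sign: the square avoids
    choosing the sign of [g], which may be negative. *)
Lemma is_derive_ln_sqr (R : realType) (V : normedModType R) (g : V -> R)
    (x v : V) (c : R) : g x != 0 -> is_derive x v g (c * g x) ->
  is_derive x v (fun y => - ln (g y ^+ 2) / 2) (- c).
Proof.
move=> g0 dg.
have g2 : 0 < g x ^+ 2 by rewrite lt_neqAle sqr_ge0 eq_sym sqrf_eq0 g0.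
have d1 : is_derive x v (fun y => g y ^+ 2) (2 * c * g x ^+ 2).
  apply: (is_derive_ext (is_deriveM dg dg)) => [y|].
    by rewrite expr2.
  by rewrite /GRing.scale /=; ring.
have d2 := @is_derive_comp1 _ _ (@ln R) (fun y => g y ^+ 2) _ _ _ _
  (is_derive1_ln g2) d1.
apply: (is_derive_ext (is_deriveZ (- 2^-1) d2)) => [y|].
  by rewrite -[LHS]/(- 2^-1 * ln (g y ^+ 2)) !mulNr mulrC.
by rewrite /GRing.scale /=; field; rewrite g0.
Qed.

(** Composing the flat isomorphism, the smooth one and the trivializations
    exp (- f_i) and exp (- f'_k) of the two Lee bundles gives nowhere zero
    functions g_ick that agree on overlaps, hence one global function.  Its
    logarithmic derivative is eta - eta' - th: the flat isomorphism
    contributes nothing, the smooth one contributes - th. *)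
Lemma lee_forms_cohomologous (R : realType) (n : nat)
    (X : complex_manifold R n) (eta th eta' : local_expr X 1)
    (L L' N : flat_line_bundle X) (f : idx L -> X -> R)
    (f' : idx L' -> X -> R) :
  lee_bundle eta f -> lee_bundle eta' f' -> flat_iso L' N ->
  deformed_bundle L th N ->
  exists u : X -> R, forall a x v, chart_image a setT x ->
    is_derive x v (fun y => u (param a y))
      (eta' a x (fun=> v) - eta a x (fun=> v) + th a x (fun=> v)).
Proof.
move=> [_ fs fd fc] [_ f's f'd f'c] [h' [h'l h'0 h'c]].
move=> /deformed_bundle_log_derivative[h [h0 hc hd]].
have [io ioP] := choice (@cov_cover _ _ _ L).
have [co coP] := choice (@cov_cover _ _ _ N).
have [ko koP] := choice (@cov_cover _ _ _ L').
pose g i c k p := h i c p / h' k c p * expR (f i p - f' k p).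
have gE i j c d k l p : cov i p -> cov j p -> cov c p -> cov d p ->
    cov k p -> cov l p -> g i c k p = g j d l p.
  move=> ip jp cp dp kp lp.
  have n1 := cocycle_neq0 cp dp.
  have n2 := h'0 _ _ _ kp cp; have n3 := h'0 _ _ _ lp dp.
  have e1 : h i c p = expR (- (f i p - f j p)) * h j d p / cocycle c d p.
    by rewrite -fc // -(hc i j c d) // mulfK.
  have e2 : h' k c p = expR (- (f' k p - f' l p)) * h' l d p / cocycle c d p.
    by rewrite -f'c // -(h'c k l c d) // mulfK.
  rewrite /g e1 e2.
  have -> : f i p - f' k p =
    (f j p - f' l p) + (f i p - f j p) - (f' k p - f' l p) by ring.
  rewrite !(expRN, expRD).
  have x1 := expR_gt0 (f i p); have x2 := expR_gt0 (f j p).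
  have x3 := expR_gt0 (f' k p); have x4 := expR_gt0 (f' l p).
  by field; rewrite n1 n3 !gt_eqF.
(* The indices chosen at p do not matter, so near a point they can be kept
   constant. *)
exists (fun p => - ln (g (io p) (co p) (ko p) p ^+ 2) / 2) => a x v ax.
have := ioP (param a x); have := coP (param a x); have := koP (param a x).
move: (io (param a x)) (co (param a x)) (ko (param a x)) => i c k kx cx ix.
have Np : \forall p \near param a x, cov i p /\ cov c p /\ cov k p.
  apply: filterI; first exact: open_nbhs_nbhs (conj (@cov_open _ _ _ _ i) ix).
  apply: filterI; first exact: open_nbhs_nbhs (conj (@cov_open _ _ _ _ c) cx).
  exact: open_nbhs_nbhs (conj (@cov_open _ _ _ _ k) kx).
have Nx := chart_image_near ax Np.
have g0 p : cov i p -> cov c p -> cov k p -> g i c k p != 0.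
  move=> ip cp kp; rewrite !mulf_neq0 ?invr_eq0 ?h0 ?h'0 //.
  by rewrite gt_eqF // expR_gt0.
apply: (@near_eq_is_derive _ _ _
  (fun y => - ln (g i c k (param a y) ^+ 2) / 2)).
  apply: filterS Nx => y /chart_imageP[_ _ [iy [cy ky]]].
  by rewrite (@gE i (io (param a y)) c (co (param a y)) k (ko (param a y))).
have /chart_imageP[xx1 xx2 _] := ax.
have axi : chart_image a (cov i) x by apply/chart_imageP.
have axk : chart_image a (cov k) x by apply/chart_imageP.
have df w : is_derive x w (fun y => f i (param a y)) (eta a x (fun=> w)).
  rewrite (fd i a x axi) (dform0E _ _ _ _ (fun=> 0)).
  have /smooth_functionP/(_ a) fsm := fs i.
  by apply: derivableP; exact: smooth_on_derivable fsm axi.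
have df' w : is_derive x w (fun y => f' k (param a y)) (eta' a x (fun=> w)).
  rewrite (f'd k a x axk) (dform0E _ _ _ _ (fun=> 0)).
  have /smooth_functionP/(_ a) fsm := f's k.
  by apply: derivableP; exact: smooth_on_derivable fsm axk.
have dh : is_derive x v (fun y => h i c (param a y))
    (- (th a x (fun=> v) * h i c (param a x))).
  by apply: hd; apply/chart_imageP.
have dh' : is_derive x v (fun y => (h' k c (param a x))^-1) 0.
  exact: is_derive_cst.
have de := is_derive_comp1 (is_derive_expR _) (is_deriveB (df v) (df' v)).
have dg := is_deriveM (is_deriveM dh dh') de.
(* The flat isomorphism is locally constant, so it differentiates to 0. *)
have Nh' : \forall y \near x, h' k c (param a y) = h' k c (param a x).
  have ackx : (cov k `&` cov c) (param a x) by [].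
  have N1 := chart_image_near ax (h'l k c _ ackx).
  by apply: filterS N1 => y /chart_imageP[_ _].
have {}dg : is_derive x v (fun y => g i c k (param a y))
    ((eta a x (fun=> v) - eta' a x (fun=> v) - th a x (fun=> v)) *
     g i c k (param a x)).
  apply: (@near_eq_is_derive _ _ _ (fun y => h i c (param a y) /
    h' k c (param a x) * expR (f i (param a y) - f' k (param a y)))).
    by apply: filterS Nh' => y E; rewrite /g E.
  apply: (is_derive_ext dg) => [y //|].
  rewrite /g /GRing.scale /=.
  rewrite -[X in expR X]/(f i (param a x) - f' k (param a x)).
  rewrite -[X in X * (expR _ * _)]/(h i c (param a x) / h' k c (param a x)).
  by ring.
have gx0 := g0 _ ix cx kx.
apply: (is_derive_ext (@is_derive_ln_sqr _ _ (fun y => g i c k (param a y)) _ _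
  _ gx0 dg)) => [y //|].
ring.
Qed.

(** * The obstruction to deforming the l.c.k. form *)

(** The multiplication by exp (- f_i) carries d - eta /\ to the exterior
    derivative of forms with values in the bundle. *)
Lemma twist_primitive (R : realType) (n : nat) (X : complex_manifold R n)
    (eta : local_expr X 1) (L : flat_line_bundle X) (f : idx L -> X -> R)
    k (al : local_expr X k) (be : local_expr X k.+1) :
  lee_bundle eta f -> is_form setT al ->
  (forall a x v, chart_image a setT x ->
    dform al a x v = wedge1 eta al a x v + be a x v) ->
  cohomology_class_eq0 (twist f be).
Proof.
move=> [_ fs fd fc] alf alE; exists (twist f al).
  split=> [i|i j a x ax v].
    have oW : open (cov i `&` setT) by rewrite setIT; exact: cov_open.
    apply: is_formM oW _ (is_formS _ alf); last by [].
    rewrite setIT; apply/smooth_functionP => a.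
    have oi := @chart_image_open _ _ _ a _ (@cov_open _ _ _ _ i).
    apply: (smooth_on_expR oi); apply: (smooth_onN oi).
    exact: (smooth_functionP _ _).1 (fs i) a.
  have /chart_imageP[_ _ [[ix jx] _]] := ax.
  rewrite /twist /mulf (fc i j) // mulrA -expRD; congr (expR _ * _); ring.
move=> i a x ax v; rewrite /d_bundle /twist.
have /chart_imageP[_ _ [ix _]] := ax.
have axi : chart_image a (cov i) x by apply: chart_imageS ax => p [].
have axT : chart_image a setT x by exact: chart_imageS ax.
have df w : is_derive x w (fun y => expR (- f i (param a y)))
    (- expR (- f i (param a x)) * eta a x (fun=> w)).
  have fi : is_derive x w (fun y => f i (param a y)) (eta a x (fun=> w)).
    rewrite (fd i a x axi) (dform0E _ _ _ _ (fun=> 0)).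
    have fsm := (smooth_functionP _ _).1 (fs i) a.
    by apply: derivableP; exact: smooth_on_derivable fsm axi.
  apply: (is_derive_ext (@is_derive_comp1 _ _ expR (fun y => - f i (param a y))
    _ _ _ _ (is_derive_expR _) (is_deriveN fi))) => //.
  by rewrite mulrN mulNr.
rewrite dformM.
- rewrite (@wedge1_eq _ _ _ _ _
    (mulf (fun p => - expR (- f i p)) eta) _ al); first last.
  + by [].
  + move=> u; rewrite (dform0E _ _ _ _ (fun=> 0)) /form0 /mulf.
    by have [_ ->] := df (u ord0); rewrite -form1E.
  by rewrite wedge1Ml /mulf alE //; ring.
- by move=> w; have [] := df w.
- by move=> w u; exact: is_form_derivable alf axT.
Qed.

Lemma lee_form_unique (R : realType) (n : nat) (X : complex_manifold R n)
    (om om' : local_expr X 2) (eta eta' : local_expr X 1) : (1 < n)%N ->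
  fundamental_form om -> fundamental_form om' -> form_eq setT om om' ->
  lee_form om eta -> lee_form om' eta' -> form_eq setT eta eta'.
Proof.
move=> n1 omf om'f E lee lee' a x ax v.
have c0 : (n + n)%:R - 2 != 0 :> R.
  by rewrite gt_eqF // subr_gt0 ltr_nat addnn (ltn_double 1).
apply: (mulfI c0); rewrite -(symplectic_traceE _ omf lee ax).
rewrite -(symplectic_traceE _ om'f lee' ax) /symplectic_trace.
have -> : gram om a x = gram om' a x by apply/matrixP => i j; rewrite !mxE E.
by under eq_bigr do under eq_bigr do rewrite (dform_eq openT E) //.
Qed.

Lemma lee_equation_derivative (R : realType) (n : nat)
    (X : complex_manifold R n) (e : R) (om : R -> local_expr X 2)
    (eta : R -> local_expr X 1) a x v :
  0 < e -> smooth_family e om -> smooth_family e eta ->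
  (forall s, `|s| < e -> lee_form (om s) (eta s)) -> chart_image a setT x ->
  dform (dot0 om) a x v =
    wedge1 (dot0 eta) (om 0) a x v + wedge1 (eta 0) (dot0 om) a x v.
Proof.
move=> e0 omf etaf lee ax.
have [_ <-] := dform_dot0 v e0 omf ax.
have [_ <-] := wedge1_dot0 v e0 etaf omf ax.
have N : \forall s \near (0 : R), `|s| < e by exact: nbhs0_lt.
apply: near_eq_derive; apply: filterS N => s se.
by have [_ ->] := lee s se.
Qed.

Lemma dot0D (R : realType) (n : nat) (X : complex_manifold R n) (e : R) k
    (al be : R -> local_expr X k) a x v :
  0 < e -> smooth_family e al -> smooth_family e be -> chart_image a setT x ->
  dot0 (fun s => addf (al s) (be s)) a x v = addf (dot0 al) (dot0 be) a x v.
Proof.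
move=> e0 alf bef ax; rewrite {1}/dot0 derive1E.
have [_ Da] := @dot0E _ _ _ _ _ al a x v e0 alf ax.
have [_ Db] := @dot0E _ _ _ _ _ be a x v e0 bef ax.
by have [_ ->] := is_deriveD Da Db.
Qed.

Theorem theorem2p4 (R : realType) (n : nat) (X : complex_manifold R n)
    (X_compact : compact [set: X])
    (om : local_expr X 2) (om_lck : lck_form om)
    (eta : local_expr X 1) (eta_lee : lee_form om eta)
    (L : flat_line_bundle X) (f : idx L -> X -> R)
    (L_om : lee_bundle eta f)
    (e : R) (e_gt0 : 0 < e)
    (etas : R -> local_expr X 1)
    (etas_smooth : smooth_family e etas)
    (etas_closed : forall s, `|s| < e -> closed_form setT (etas s))
    (etas0 : form_eq setT (etas 0) zerof)
    (Ls : R -> flat_line_bundle X) (Ls0 : Ls 0 = L)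
    (Ls_etas : forall s, `|s| < e -> deformed_bundle L (etas s) (Ls s))
    (class_neq0 :
       ~ cohomology_class_eq0 (twist f (wedge1 (dot0 etas) om))) :
  ~ exists (d : R) (oms : R -> local_expr X 2),
      [/\ 0 < d <= e,
          smooth_family d oms,
          form_eq setT (oms 0) om
        & forall s, `|s| < d ->
            lck_form (oms s) /\ corresponding_bundle (oms s) (Ls s)].
Proof.
move=> [d [oms [/andP[d0 de] omsf oms0 omsL]]]; apply: class_neq0.
have [omf _] := om_lck.
(* In real dimension at most 2 the 3-form representing the class is 0. *)
have [n1|n1] := leqP n 1.
  apply: (twist_primitive L_om (@is_form_zerof _ _ _ setT 2)) => a x v ax.
  rewrite (wedge1_dim_le1 v n1 (dot0_form e_gt0 etas_smooth) omf ax) addr0.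
  rewrite /dform /wedge1 !big1 // => i _; first by rewrite /zerof mulr0.
  by rewrite /zerof (@derive_cst R) mulr0.
have etasf := smooth_familyS de etas_smooth.
have fam s : exists p : local_expr X 1 * (X -> R), `|s| < d ->
    lee_form (oms s) p.1 /\ forall a x v, chart_image a setT x ->
      is_derive x v (fun y => p.2 (param a y))
        (p.1 a x (fun=> v) - eta a x (fun=> v) + etas s a x (fun=> v)).
  have [sd|sd] := ltP `|s| d; last first.
    by exists (zerof, fun=> 0) => sd'.
  have [_ [eta' [L' [f' [lee' L'f' L'N]]]]] := omsL s sd.
  have [u du] := lee_forms_cohomologous L_om L'f' L'N
    (Ls_etas s (lt_le_trans sd de)).
  by exists (eta', u).
have {fam}[p pP] := choice fam.
pose lees s := (p s).1.
have lee s : `|s| < d -> lee_form (oms s) (lees s) by move=> /pP[].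
have omsF s : `|s| < d -> fundamental_form (oms s) by move=> /omsL[[]].
have leef : smooth_family d lees by exact: lee_form_family n1 omsf omsF lee.
have z0 : `|0 : R| < d by rewrite normr0.
have lee0 : form_eq setT (lees 0) eta.
  exact: lee_form_unique n1 (omsF 0 z0) omf oms0 (lee 0 z0) eta_lee.
pose beta s := addf (lees s) (etas s).
have betaf : smooth_family d beta by exact: smooth_familyD.
have betac s : `|s| < d -> closed_form setT (beta s).
  move=> sd; apply: (closed_formD openT); first exact: (lee s sd).1.
  exact: etas_closed (lt_le_trans sd de).
have covA i : acyclic (@cov _ _ _ L i).
  have [gc _ _ _] := L_om; rewrite -(bigcap_set1 (@cov _ _ _ L) i).
  by apply: gc; [exact: finite_set1|exists i].
have [w ws wth] : exists2 w : X -> R, smooth_function setT w &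
    form_eq setT (dform (form0 w)) (dot0 beta).
  apply: (@family_potential _ _ _ d beta _ (@cov _ _ _ L) (fun s => (p s).2))
    => //; [exact: cov_open|exact: cov_cover|].
  move=> s a x v sd ax; have [_ /(_ a x v ax) D] := pP s sd.
  apply: (is_derive_ext D) => // .
  by rewrite /beta /addf lee0 // etas0 // /zerof /lees; ring.
have odf := dot0_form d0 omsf.
(* Heuristically, minus the derivative at 0 of exp (- u_s) om_s, the conformal
   form whose Lee form is eta - eta_s. *)
pose kappa := addf (mulf w om) (mulf (fun=> -1) (dot0 oms)).
have kappaf : is_form setT kappa.
  have [omform _] := omf.
  apply: (is_formD openT (is_formM openT ws omform)).
  exact: is_formM openT (smooth_function_cst _ _) odf.
apply: (twist_primitive L_om kappaf) => a x v ax.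
have [omform _] := omf.
have wd u : derivable (fun y => w (param a y)) x u.
  exact: smooth_on_derivable ((smooth_functionP _ _).1 ws a) ax.
have omd u u' : derivable (fun y => om a y u') x u.
  exact: is_form_derivable omform ax.
have odd u u' : derivable (fun y => dot0 oms a y u') x u.
  exact: is_form_derivable odf ax.
rewrite dformD; first last.
- by move=> u u'; exact: derivableZ.
- by move=> u u'; exact: derivableM.
rewrite dformM // dformZ // (lee_equation_derivative v d0 omsf leef lee ax).
have [_ omeq] := eta_lee.
rewrite (@wedge1_eq _ _ _ _ _ (dot0 beta) _ om); first last.
- by [].
- by move=> u; exact: wth.
rewrite (@wedge1_eq _ _ _ _ (dot0 beta) (addf (dot0 lees) (dot0 etas)) _ om);
  first last.
- by [].
- by move=> u; exact: dot0D d0 leef etasf ax.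
rewrite (@wedge1_eq _ _ _ _ (dot0 lees) (dot0 lees) (oms 0) om); first last.
- by move=> u; exact: oms0.
- by [].
rewrite (@wedge1_eq _ _ _ _ (lees 0) eta (dot0 oms) (dot0 oms)); first last.
- by [].
- by move=> u; exact: lee0.
rewrite wedge1Dl wedge1Dr !wedge1Mr /mulf omeq //.
ring.
Qed.
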